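(* Let $X=GI(n;J)$ with $J=(j_0,\dots,j_{t-1})$, let $A(n;J)=\mathrm{Aut}(GI(n;J))$ and $F(n;J)=|A(n;J)|$. (i) Let $d=\gcd(n,j_0,\dots,j_{t-1})$, and let $J/d=(j_0/d,\dots,j_{t-1}/d)$. Then $A(n;J)\cong A(n/d;J/d)\wr \mathrm{Sym}(d)$, the wreath product of $A(n/d;J/d)$ by the symmetric group $\mathrm{Sym}(d)$ of degree $d$, and hence $F(n;J)=d!\,(F(n/d;J/d))^d$. (ii) Suppose $J$ is in standard form and is a set (no repeated elements), and $X$ is connected but not edge-transitive. Let $A=\{a\in\mathbb{Z}_n^{*} : a(J\cup -J)=J\cup -J\}$. Then $A$ is a subgroup of $\mathbb{Z}_n^{*}$, the set $S=\{\sigma_a: a\in A\}$ is a subgroup of $\mathrm{Aut}(X)$ isomorphic to $A$, and $A(n;J)=\langle \{\rho\}\cup S\rangle=\langle\rho\rangle\rtimes S\cong C_n\rtimes A$, with $\sigma_a^{-1}\rho\sigma_a=\rho^a$ for all $a\in A$ (composing from left to right). In particular $F(n;J)=n|A|$. (iii) Suppose $J$ is in standard form and is a multiset with repeated elements, and $X$ is connected but not edge-transitive. For each $j$ in the underlying set of $J$ let $m_j$ be the multiplicity of $j$ in $J$ and let $d_j=\gcd(n,j)$. Let $B$ be the subgroup of all $a\in\mathbb{Z}_n^{*}$ such that $aJ=\{\pm j_0,\pm j_1,\dots,\pm j_{t-1}\}$ as multisets (for some choice of signs). Let $S=\{\sigma_a:a\in B\}$, which is a subgroup of $\mathrm{Aut}(X)$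 isomorphic to $B$, and let $N$ be the subgroup generated by all the automorphisms $\lambda_{i,s_1,s_2}$. Then $N$ is normal in $\mathrm{Aut}(X)$, $N\cong\prod_j \mathrm{Sym}(m_j)^{d_j}$, and $$A(n;J)=\langle N\cup\{\rho\}\cup S\rangle\cong N\rtimes\langle\rho\rangle\rtimes S\cong \prod_{j}\mathrm{Sym}(m_j)^{d_j}\rtimes C_n\rtimes B,$$ of order $F(n;J)=n\,|B|\prod_{j}(m_j!)^{d_j}$, where the products are over all $j$ in the underlying set of $J$ (without multiplicities).
   Context: For integers $n\ge 3$, $t\ge 1$ and a sequence (equivalently, multiset) $J=(j_0,\dots,j_{t-1})$ of integers with $0<j_k<n$ and $j_k\neq n/2$, the $GI$-graph $GI(n;J)=GI(n;j_0,\dots,j_{t-1})$ is the graph with vertex set $\mathbb{Z}_t\times\mathbb{Z}_n$ and two types of edges: spoke edges, joining $(s,v)$ to $(s',v)$ for all distinct $s,s'\in\mathbb{Z}_t$ and all $v\in\mathbb{Z}_n$; and layer edges, joining $(s,v)$ to $(s,v+j_s)$ and $(s,v-j_s)$ for all $s\in\mathbb{Z}_t$, $v\in\mathbb{Z}_n$. $J$ is in standard form if $0<j_k<n/2$ for all $k$ and $j_0\le j_1\le\dots\le j_{t-1}$. $\mathbb{Z}_n^{*}$ is the group of units mod $n$; $C_n$ is the cyclic group of order $n$; elements of $J$ are viewed mod $n$ in $J\cup -J$ and $aJ$. The following are automorphisms of $X=GI(n;J)$. The rotation $\rho$ is $\rho(s,v)=(s,v+1)$. For $s_1\neq s_2$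 with $j_{s_1}=j_{s_2}$, $d=\gcd(n,j_{s_1})$ and $i\in\mathbb{Z}_d$, the map $\lambda_{i,s_1,s_2}$ interchanges $(s_1,v)$ and $(s_2,v)$ for every $v\equiv i \pmod d$ and fixes all other vertices. For a unit $a\in\mathbb{Z}_n$ with $aJ=\{\pm j_0,\dots,\pm j_{t-1}\}$ (as multisets, for some choice of signs), $\sigma_a(s,v)=(\alpha(s),av)$, where $\alpha:\mathbb{Z}_t\to\mathbb{Z}_t$ is the bijection such that $j_{\alpha(s)}\equiv\pm aj_s \pmod n$ for all $s$, made unique by requiring $\alpha(s_1)<\alpha(s_2)$ whenever $s_1<s_2$ and $j_{s_1}=\pm j_{s_2}$ (with $\mathbb{Z}_t$ identified with $\{0,\dots,t-1\}$). *)

(* Defs.v *)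
From HB Require Import structures.
From mathcomp Require Import all_boot all_order all_algebra all_fingroup all_solvable.
Set Implicit Arguments.
Unset Strict Implicit.
Unset Printing Implicit Defensive.
Import GroupScope.

(* Products in [{perm T}] compose from left to right, [(p * q) x = q (p x)],
   and [x ^ y = y^-1 * x * y]. *)

Section FiniteGraphs.
Variables (V : finType) (e : rel V).

Definition graph_aut : {set {perm V}} :=
  [set p : {perm V} | [forall u, forall w, e (p u) (p w) == e u w]].

Lemma graph_aut_group_set : group_set graph_aut.
Proof.
apply/group_setP; split=> [|p q].
  by rewrite inE; apply/forallP=> u; apply/forallP=> w; rewrite !perm1.
rewrite !inE => /forallP pP /forallP qP.
apply/forallP=> u; apply/forallP=> w; rewrite !permM.
by rewrite (eqP (forallP (qP _) _)) (eqP (forallP (pP _) _)).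
Qed.
Canonical graph_aut_group := Group graph_aut_group_set.

Definition graph_connected : Prop := forall u w : V, connect e u w.

Definition graph_edges : {set {set V}} :=
  [set [set uw.1; uw.2] | uw : V * V & e uw.1 uw.2].

Definition edge_transitive : Prop :=
  forall E F : {set V}, E \in graph_edges -> F \in graph_edges ->
    exists2 p : {perm V}, p \in graph_aut & [set p x | x in E] = F.

End FiniteGraphs.

(* [wreath gT d] is the base group [gT ^ d] extended by ['S_d], which permutes
   the coordinates. *)
Section Wreath.
Variables (gT : finGroupType) (d : nat).
Implicit Types (x : {dffun forall _ : 'I_d, gT}) (s : 'S_d).

Definition wreath_act x s : {dffun forall _ : 'I_d, gT} :=
  [ffun i => x (s^-1 i)].

Lemma wreath_act1 x : wreath_act x 1 = x.
Proof. by apply/ffunP=> i; rewrite ffunE invg1 perm1. Qed.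

Lemma wreath_actM x : act_morph wreath_act x.
Proof. by move=> s1 s2; apply/ffunP=> i; rewrite !ffunE invMg permM. Qed.

Canonical wreath_action := TotalAction wreath_act1 wreath_actM.

Lemma wreath_is_groupAction : is_groupAction setT wreath_action.
Proof.
move=> s _ /=; rewrite inE; apply/andP; split.
  by apply/subsetP=> x _; rewrite inE.
by apply/morphicP=> x y _ _; rewrite !actpermE; apply/ffunP=> i; rewrite !ffunE.
Qed.

Canonical wreath_groupAction := GroupAction wreath_is_groupAction.

Definition wreath : finGroupType := sdprod_by wreath_groupAction.

End Wreath.

Section GIGraphs.
Variables (n t : nat) (J : t.-tuple nat).

(* ['Z_n] is Z/nZ only for [1 < n]; all uses below have [2 < n]. *)
Definition gi_vertex : finType := ('I_t * 'Z_n)%type.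

Definition gi_jump (s : 'I_t) : 'Z_n := ((tnth J s)%:R)%R.

Definition gi_spoke : rel gi_vertex :=
  [rel u w | (u.1 != w.1) && (u.2 == w.2)].

Definition gi_layer : rel gi_vertex :=
  [rel u w | (u.1 == w.1) &&
    ((w.2 == u.2 + gi_jump u.1)%R || (w.2 == u.2 - gi_jump u.1)%R)].

Definition gi_adj : rel gi_vertex := [rel u w | gi_spoke u w || gi_layer u w].

Definition gi_aut : {set {perm gi_vertex}} := graph_aut gi_adj.
Canonical gi_aut_group := [group of gi_aut].

Definition gi_standard : bool :=
  all (fun j => 0 < j.*2 < n) J && sorted leq J.

Definition gi_rot_fun (x : gi_vertex) : gi_vertex := (x.1, x.2 + 1)%R.
Lemma gi_rot_inj : injective gi_rot_fun.
Proof.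
move=> [s v] [s' v'] E.
have /= -> : (gi_rot_fun (s, v)).1 = (gi_rot_fun (s', v')).1 by rewrite E.
have /= : (gi_rot_fun (s, v)).2 = (gi_rot_fun (s', v')).2 by rewrite E.
by move/GRing.addIr->.
Qed.
Definition gi_rot : {perm gi_vertex} := perm gi_rot_inj.

(* [gi_swap_fun i s1 s2] exchanges [(s1, v)] and [(s2, v)] for
   [v = i %[mod gcdn n j_s1]]. *)
Definition gi_swap_fun (i : nat) (s1 s2 : 'I_t) (x : gi_vertex) : gi_vertex :=
  if (x.2 : nat) == i %[mod gcdn n (tnth J s1)]
  then (tperm s1 s2 x.1, x.2) else x.
Lemma gi_swap_inj i s1 s2 : injective (gi_swap_fun i s1 s2).
Proof.
apply: inv_inj; case=> s v; rewrite /gi_swap_fun /=.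
by case h: ((v : nat) == i %[mod _]); rewrite /= h ?tpermK.
Qed.
Definition gi_swap i s1 s2 : {perm gi_vertex} := perm (@gi_swap_inj i s1 s2).

Definition gi_swaps : {set {perm gi_vertex}} :=
  [set p | [exists s1 : 'I_t, exists s2 : 'I_t,
    exists i : 'I_(gcdn n (tnth J s1)),
      [&& s1 != s2, tnth J s1 == tnth J s2 & p == gi_swap i s1 s2]]].

Definition eq_pm (x y : 'Z_n) : bool := (x == y) || (x == - y)%R.

Definition gi_layer_perm_spec (a : {unit 'Z_n}) (alpha : 'S_t) : bool :=
  [forall s, eq_pm (gi_jump (alpha s)) (val a * gi_jump s)%R] &&
  [forall s1 : 'I_t, forall s2 : 'I_t,
     (s1 < s2) && eq_pm (gi_jump s1) (gi_jump s2) ==> (alpha s1 < alpha s2)].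

(* The default [1] is never reached for [a] in [gi_units_mset] below, where
   exactly one permutation meets the specification. *)
Definition gi_layer_perm (a : {unit 'Z_n}) : 'S_t :=
  odflt 1 [pick alpha | gi_layer_perm_spec a alpha].

Definition gi_mult_fun (a : {unit 'Z_n}) (x : gi_vertex) : gi_vertex :=
  (gi_layer_perm a x.1, val a * x.2)%R.
Lemma gi_mult_inj a : injective (gi_mult_fun a).
Proof.
move=> [s v] [s' v'] E.
have /= : (gi_mult_fun a (s, v)).1 = (gi_mult_fun a (s', v')).1 by rewrite E.
have /= : (gi_mult_fun a (s, v)).2 = (gi_mult_fun a (s', v')).2 by rewrite E.
by move/(GRing.mulrI (valP a))=> -> /perm_inj->.
Qed.
Definition gi_mult a : {perm gi_vertex} := perm (@gi_mult_inj a).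

Definition gi_pm_jumps : {set 'Z_n} :=
  [set gi_jump s | s : 'I_t] :|: [set (- gi_jump s)%R | s : 'I_t].

Definition gi_units_set : {set {unit 'Z_n}} :=
  [set a : {unit 'Z_n} |
    [set (val a * x)%R | x in gi_pm_jumps] == gi_pm_jumps].

Definition gi_units_mset : {set {unit 'Z_n}} :=
  [set a : {unit 'Z_n} | [exists eps : {ffun 'I_t -> bool},
    perm_eq [seq (val a * gi_jump s)%R | s <- enum 'I_t]
            [seq ((-1) ^+ (eps s) * gi_jump s)%R | s <- enum 'I_t]]].

Definition gi_gcd : nat := gcdn n (\big[gcdn/0]_(j <- J) j).

Definition gi_quo : t.-tuple nat := [tuple of [seq j %/ gi_gcd | j <- J]].

(* The indices are the distinct entries of [J]. *)
Definition gi_sym_prod : finGroupType :=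
  {dffun forall j : seq_sub J,
     {dffun forall _ : 'I_(gcdn n (val j)), 'S_(count_mem (val j) J)}}.

End GIGraphs.

Arguments gi_adj n {t} J _ _.

(* Main.v *)
Require Import Defs.
From mathcomp Require Import all_boot all_order all_algebra all_fingroup all_solvable.
From mathcomp Require Import ring zify.
Set Implicit Arguments.
Unset Strict Implicit.
Unset Printing Implicit Defensive.
Import GroupScope.

(** Let [d] be the gcd of [n] and the entries of [J].  Edges preserve the residue
    modulo [d] of the second coordinate, and each residue class carries a copy of
    GI(n/d; J/d), which is connected because its own gcd is 1.  Automorphisms of
    [d] disjoint copies of a connected graph permute the copies and act
    independently on each, which gives the wreath product of part (i)
    ([graph_aut_wreath], [adj_copy]).

    Parts (ii) and (iii) are one argument, (ii) being the case where the normal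
    subgroup [N] is trivial.  It has three steps.

    Spokes go to spokes ([aut_spoke]).  Suppose that an automorphism maps a spoke
    to a layer edge.  With two layers, the ends of that spoke both land in one
    layer, all of whose edges are in the orbit of the spokes, and pulling back
    shows that the edges of both layers are in this orbit.  With at least three
    layers a spoke lies in a triangle, while a triangle on a layer edge of jump
    [j] forces [3 j = 0] modulo [n]; all edges at a vertex of that layer then lie
    in triangles, and pulling back gives [3 j = n] for every entry of [J], so that
    the layers can be permuted freely.  Either way the graph is edge-transitive.

    Columns are mapped affinely ([aut_unit]).  An automorphism therefore permutes
    the columns, inducing a map [f] on the integers modulo [n], and maps each line
    of a layer to a line, so [f] is affine along every coset of the subgroup
    generated by a jump, with a slope that may depend on the coset.  If [f] is
    affine along two directions, then its dependence on the two coefficients is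
    linear up to a mixed term [x y C].  Writing one element of the subgroup in two
    ways shows that [C] is killed by two coprime integers, hence is zero, and [f]
    is affine along the gcd of the two directions ([affine_along_bezout]).  By
    connectedness the gcd of [n] and all the jumps is 1, so [f v = c + a v] with
    [a] a unit.

    Consequently every automorphism is a product of one fixing all columns, a
    power of the rotation and some [sigma_a] ([aut_decomposition]).  An
    automorphism fixing all columns permutes the layers of equal jump [j], and its
    layer permutation is unchanged by moving along a line, so it depends only on
    the column modulo [gcdn n j]; this group is the product of symmetric groups
    ([im_permute]), and it is generated by the swaps ([swaps_genE]). *)

(** * Recognizing external semidirect products *)

Section SemidirectTransport.
Variables gT aT rT : finGroupType.
Implicit Types (K H G : {group gT}) (D : {group aT}) (R : {group rT}).

Lemma sdprod_by_isog K H G D R (to : groupAction D R)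
    (f : {morphism R >-> gT}) (h : {morphism D >-> gT}) :
  'injm f -> 'injm h -> f @* R = K -> h @* D = H ->
  {in R & D, morph_act to 'J f h} -> K ><| H = G ->
  G \isog [set: sdprod_by to].
Proof.
move=> injf injh imf imh act /sdprodP[_ defG _ tiKH].
rewrite isog_sym; apply/isogP; exists (xsdprod_morphism act).
  by rewrite injm_xsdprodm injf injh imf imh tiKH eqxx.
by rewrite /= im_xsdprodm imf imh.
Qed.

(** The action is conjugation in [G], transported along the two isomorphisms. *)
Lemma sdprod_by_exists K H G D R :
  K ><| H = G -> K \isog R -> H \isog D ->
  exists to : groupAction D R, G \isog [set: sdprod_by to].
Proof.
move=> defG; rewrite isog_sym => /isogP[f injf imf].
rewrite isog_sym => /isogP[h injh imh].
have [_ _ nKH _] := sdprodP defG.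
have hH a : a \in D -> h a \in H by move=> Da; rewrite -imh mem_morphim.
have fK x : x \in R -> f x \in K by move=> Rx; rewrite -imf mem_morphim.
have im x a : x \in R -> a \in D -> f x ^ h a \in f @* R.
  by move=> Rx Da; rewrite imf memJ_norm ?fK // (subsetP nKH) ?hH.
pose to x a := if (x \in R) && (a \in D) then invm injf (f x ^ h a) else x.
have toR x a : x \in R -> a \in D -> to x a \in R.
  move=> Rx Da; rewrite /to Rx Da /=.
  by have:= mem_morphim (invm injf) (im x a Rx Da) (im x a Rx Da); rewrite im_invm.
have fto x a : x \in R -> a \in D -> f (to x a) = f x ^ h a.
  by move=> Rx Da; rewrite /to Rx Da /= invmK ?im.
have to_out x a : x \notin R -> to x a = x by rewrite /to => /negPf->.
have inj_to a : injective (to^~ a).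
  move=> x y; case Da: (a \in D); last by rewrite /to Da !andbF.
  case Rx: (x \in R); case Ry: (y \in R).
  - move=> /(congr1 f); rewrite !fto // => /conjg_inj.
    exact: (injmP injf).
  - by rewrite (to_out y) ?Ry // => E; rewrite -E toR in Ry.
  - by rewrite (to_out x) ?Rx // => E; rewrite E toR in Rx.
  - by rewrite !to_out ?Rx ?Ry.
have toM : {in D &, forall a b, to^~ (a * b) =1 fun x => to (to x a) b}.
  move=> a b Da Db x; case Rx: (x \in R); last by rewrite !to_out ?Rx.
  apply: (injmP injf); rewrite ?toR ?groupM ?fto ?toR ?groupM //.
  by rewrite morphM // conjgM.
have acto : is_action D to by split=> // a b Da Db x; apply: toM.
have gacto : is_groupAction R (Action acto).
  move=> a Da; rewrite inE; apply/andP; split.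
    apply/subsetP=> x; rewrite inE actpermE /=.
    by apply: contraR => /to_out->.
  apply/morphicP=> x y Rx Ry; rewrite !actpermE /=.
  apply: (injmP injf); rewrite ?groupM ?toR ?groupM //.
  by rewrite fto ?groupM // !morphM ?toR // conjMg !fto.
exists (GroupAction gacto).
apply: (sdprod_by_isog injf injh imf imh _ defG) => x a Rx Da.
exact: fto.
Qed.

End SemidirectTransport.

(** * Automorphisms of disjoint copies of a connected graph *)

Section GraphAut.
Variables (V : finType) (e : rel V).

Lemma graph_autP (p : {perm V}) :
  reflect (forall u w, e (p u) (p w) = e u w) (p \in graph_aut e).
Proof.
rewrite inE; apply: (iffP forallP) => [h u w|h u].
  exact/eqP/(forallP (h u)).
by apply/forallP=> w; rewrite h.
Qed.

End GraphAut.

Section DisjointCopies.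
Variables (V W : finType) (e : rel V) (eW : rel W) (d : nat).
Variables (phi : W * 'I_d -> V) (psi : V -> W * 'I_d) (w0 : W).
Hypotheses (phiK : cancel phi psi) (psiK : cancel psi phi).
Hypothesis e_phi : forall x i y k, e (phi (x, i)) (phi (y, k)) = (i == k) && eW x y.
Hypothesis conW : graph_connected eW.

Local Notation AW := (graph_aut_group eW).
Local Notation base := {dffun forall _ : 'I_d, [subg AW]%type}.

(** The copy containing the image is locally constant, hence constant on a
    connected graph. *)
Lemma aut_component p i x : p \in graph_aut e ->
  (psi (p (phi (x, i)))).2 = (psi (p (phi (w0, i)))).2.
Proof.
move=> /graph_autP pA; set c := (psi (p (phi (w0, i)))).2.
pose a := [pred y | (psi (p (phi (y, i)))).2 == c].
have cla : closed eW a.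
  move=> y z; have := pA (phi (y, i)) (phi (z, i)); rewrite e_phi eqxx /= => <-.
  rewrite -[p (phi (y, _))]psiK -[p (phi (z, _))]psiK !inE.
  case: (psi (p (phi (y, i)))) => y' k; case: (psi (p (phi (z, i)))) => z' l.
  by rewrite e_phi /= => /andP[/eqP->].
by have := closed_connect cla (conW w0 x); rewrite !inE eqxx => /esym/eqP.
Qed.

(** The map induced on copies is injective because the inverse automorphism induces
    a left inverse of it. *)
Lemma aut_copies p : p \in graph_aut e ->
  exists s : 'S_d, exists f : base,
    forall x i, p (phi (x, i)) = phi (sgval (f i) x, s i).
Proof.
move=> pA; have pVA : p^-1 \in graph_aut e by rewrite groupV.
pose c i := (psi (p (phi (w0, i)))).2.
have cE x i : p (phi (x, i)) = phi ((psi (p (phi (x, i)))).1, c i).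
  by rewrite /c -(aut_component i x pA) -surjective_pairing psiK.
have c_inj : injective c.
  apply: (can_inj (g := fun i => (psi (p^-1 (phi (w0, i)))).2)) => i.
  by rewrite -(aut_component _ (psi (p (phi (w0, i)))).1 pVA) -cE permK phiK.
pose f i x := (psi (p (phi (x, i)))).1.
have f_inj i : injective (f i).
  move=> x y E; have : p (phi (x, i)) = p (phi (y, i)).
    by rewrite cE [RHS]cE -/(f i x) E.
  by move/perm_inj/(can_inj phiK) => [].
have fA i : perm (f_inj i) \in AW.
  apply/graph_autP => x y; rewrite !permE.
  move/graph_autP: pA => /(_ (phi (x, i)) (phi (y, i))).
  by rewrite cE [p (phi (y, _))]cE !e_phi !eqxx.
exists (perm c_inj), [ffun i => subg AW (perm (f_inj i))] => x i.
by rewrite ffunE subgK // !permE -cE.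
Qed.

Definition copies_fun (f : base) v :=
  phi (sgval (f (psi v).2) (psi v).1, (psi v).2).

Lemma copies_inj f : injective (copies_fun f).
Proof.
move=> u v /(can_inj phiK)[] + E; rewrite E => /perm_inj E1.
by rewrite -[u]psiK -[v]psiK; case: (psi u) (psi v) E E1 => ? ? [? ?] /= -> ->.
Qed.

Definition copies_perm f : {perm V} := perm (@copies_inj f).

Lemma copies_permE f x i : copies_perm f (phi (x, i)) = phi (sgval (f i) x, i).
Proof. by rewrite permE /copies_fun phiK. Qed.

Definition shift_fun (s : 'S_d) v := phi ((psi v).1, s (psi v).2).

Lemma shift_inj s : injective (shift_fun s).
Proof.
move=> u v /(can_inj phiK)[] E /perm_inj E1.
by rewrite -[u]psiK -[v]psiK; case: (psi u) (psi v) E E1 => ? ? [? ?] /= -> ->.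
Qed.

Definition shift_perm s : {perm V} := perm (@shift_inj s).

Lemma shift_permE s x i : shift_perm s (phi (x, i)) = phi (x, s i).
Proof. by rewrite permE /shift_fun phiK. Qed.

Lemma eq_perm_phi (p q : {perm V}) :
  (forall x i, p (phi (x, i)) = q (phi (x, i))) -> p = q.
Proof. by move=> E; apply/permP=> v; rewrite -[v]psiK; case: (psi v). Qed.

Lemma copies_permM : {in [set: base] &, {morph copies_perm : f g / f * g}}.
Proof.
move=> f g _ _; apply: eq_perm_phi => x i.
by rewrite permM !copies_permE ffunE permM.
Qed.
Canonical copies_morphism := Morphism copies_permM.

Lemma shift_permM : {in [set: 'S_d] &, {morph shift_perm : s t / s * t}}.
Proof.
move=> s t _ _; apply: eq_perm_phi => x i.
by rewrite permM !shift_permE permM.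
Qed.
Canonical shift_morphism := Morphism shift_permM.

Lemma injm_copies : 'injm copies_perm.
Proof.
apply/injmP=> f g _ _ E; apply/ffunP => i; apply: val_inj; apply/permP => x.
by have /(congr1 (fun p : {perm V} => psi (p (phi (x, i))))) := E;
  rewrite !copies_permE !phiK => [[]].
Qed.

Lemma injm_shift : 'injm shift_perm.
Proof.
apply/injmP=> s t _ _ E; apply/permP => i.
by have /(congr1 (fun p : {perm V} => psi (p (phi (w0, i))))) := E;
  rewrite !shift_permE !phiK => [[]].
Qed.

Lemma copies_aut f : copies_perm f \in graph_aut e.
Proof.
apply/graph_autP=> u v; rewrite -[u]psiK -[v]psiK.
case: (psi u) (psi v) => x i [y k]; rewrite !copies_permE !e_phi.
case: eqP => //= ->.
by have /graph_autP -> := subgP (f k).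
Qed.

Lemma shift_aut s : shift_perm s \in graph_aut e.
Proof.
apply/graph_autP=> u v; rewrite -[u]psiK -[v]psiK.
case: (psi u) (psi v) => x i [y k]; rewrite !shift_permE !e_phi.
by rewrite (inj_eq perm_inj).
Qed.

(** Conjugating by a permutation of the copies permutes the coordinates exactly as
    in the wreath product. *)
Lemma copies_shift_act :
  {in [set: base] & [set: 'S_d],
    morph_act (wreath_groupAction [subg AW]%type d) 'J copies_perm shift_perm}.
Proof.
move=> f s _ _; apply: eq_perm_phi => x i /=.
rewrite copies_permE ffunE /conjg !permM.
have -> : phi (x, i) = shift_perm s (phi (x, s^-1 i)) by rewrite shift_permE permKV.
by rewrite permK copies_permE shift_permE permKV.
Qed.

Lemma copies_shift_sdprod :
  (copies_perm @* setT) ><| (shift_perm @* setT) = graph_aut e.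
Proof.
rewrite sdprodE.
- apply/eqP; rewrite eqEsubset; apply/andP; split.
    apply/subsetP=> _ /mulsgP[_ _ /morphimP[f _ _ ->] /morphimP[s _ _ ->] ->].
    exact: groupM (copies_aut f) (shift_aut s).
  apply/subsetP=> p /aut_copies [s [f pE]].
  have -> : p = copies_perm f * shift_perm s.
    by apply: eq_perm_phi => x i; rewrite pE permM copies_permE shift_permE.
  by rewrite mem_mulg // mem_morphim ?inE.
- apply/subsetP=> _ /morphimP[s _ _ ->]; rewrite inE.
  apply/subsetP=> _ /imsetP[_ /morphimP[f _ _ ->] ->].
  by rewrite -copies_shift_act ?inE // mem_morphim ?inE.
apply/trivgP/subsetP=> _ /setIP[/morphimP[f _ _ ->] /morphimP[s _ _ E]].
have s1 : s = 1.
  apply/permP=> i; have /(congr1 (fun p : {perm V} => psi (p (phi (w0, i))))) := E.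
  by rewrite copies_permE shift_permE !phiK perm1 => [[]].
by rewrite E s1 morph1 inE.
Qed.

Lemma graph_aut_wreath : graph_aut e \isog [set: wreath [subg AW]%type d].
Proof.
exact: (sdprod_by_isog injm_copies injm_shift erefl erefl copies_shift_act
          copies_shift_sdprod).
Qed.

Lemma card_graph_aut_wreath : #|graph_aut e| = (d`! * #|graph_aut eW| ^ d)%N.
Proof.
rewrite -(sdprod_card copies_shift_sdprod) !card_injm ?injm_copies ?injm_shift //.
rewrite cardsT card_ffun card_ord mulnC card_Sym card_ord; congr (_ * _ ^ _)%N.
by rewrite -cardsT -(card_injm (injm_sgval AW)) ?im_sgval ?subxx.
Qed.

End DisjointCopies.

(** * Adjacency and connectedness *)

Section ZnNat.
Local Open Scope nat_scope.
Variable n : nat.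
Hypothesis hn : 1 < n.

Lemma Zn_nat_eq a b : ((a%:R)%R == (b%:R)%R :> 'Z_n) = (a == b %[mod n]).
Proof. by rewrite -val_eqE /= !val_Zp_nat. Qed.

Lemma Zn_natr (v : 'Z_n) : ((v : nat)%:R)%R = v.
Proof. exact: natr_Zp. Qed.

Lemma ltn_Zn (v : 'Z_n) : v < n.
Proof. by rewrite -[X in _ < X](Zp_cast hn). Qed.

Lemma Zn_add_natr (v : 'Z_n) a : (v + a%:R)%R = ((v + a)%:R)%R.
Proof. by rewrite GRing.natrD Zn_natr. Qed.

Lemma Zn_nat_n : (n%:R)%R = 0%R :> 'Z_n.
Proof. exact: pchar_Zp. Qed.

End ZnNat.

Lemma eqn_mod_mixed D M (i k : 'I_D) a b :
  (i + D * a == k + D * b %[mod D * M])%N = (i == k) && (a == b %[mod M]).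
Proof.
have D0 : (0 < D)%N by apply: leq_ltn_trans (leq0n i) (ltn_ord i).
case: (eqVneq i k) => [->|ik] /=.
  by rewrite eqn_modDl -!muln_modr eqn_pmul2l.
apply: contraNF ik => /eqP/(congr1 (modn^~ D)).
rewrite !modn_dvdm ?dvdn_mulr // ![(_ + D * _)%N]addnC !(mulnC D) !modnMDl.
by rewrite !modn_small // => /val_inj->.
Qed.

Section GIBasics.
Local Open Scope nat_scope.
Variables (n t : nat) (J : t.-tuple nat).
Hypothesis hn : 2 < n.
Hypothesis hJ : forall j, j \in J -> 0 < j < n /\ j.*2 <> n.

Local Notation jump := (gi_jump n J).
Local Notation adj := (gi_adj n J).
Local Notation G := (gi_aut n J).

Let hn1 : 1 < n. Proof. exact: ltnW. Qed.

Lemma jump_neq0 s : jump s != 0%R.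
Proof.
have [/andP[j0 jn] _] := hJ (mem_tnth s J).
rewrite /gi_jump -(GRing.mulr0n 1%R) Zn_nat_eq // mod0n modn_small //.
by rewrite -lt0n.
Qed.

Lemma jump2_neq0 s : (jump s + jump s)%R != 0%R.
Proof.
have [/andP[j0 jn] j2] := hJ (mem_tnth s J).
rewrite /gi_jump -GRing.natrD -(GRing.mulr0n 1%R) Zn_nat_eq // mod0n addnn.
apply/negP=> /dvdnP[k E]; apply: j2; rewrite E.
have k0 : 0 < k by case: k E => // E; rewrite -double_gt0 E in j0.
have k2 : k < 2 by rewrite -(ltn_pmul2r (ltnW hn1)) -E mul2n ltn_double.
have -> : k = 1 by apply/eqP; rewrite eqn_leq -ltnS k2 k0.
by rewrite mul1n.
Qed.

Lemma layer_sym : symmetric (@gi_layer n t J).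
Proof.
have E (a b c : 'Z_n) : (a == b + c)%R = (b == a - c)%R.
  by rewrite (eq_sym b) GRing.subr_eq.
move=> u w; rewrite /gi_layer /= (eq_sym w.1); case: eqP => //= ->.
by rewrite orbC -E (E w.2).
Qed.

Lemma spoke_sym : symmetric (@gi_spoke n t).
Proof. by move=> u w; rewrite /gi_spoke /= (eq_sym w.1) (eq_sym w.2). Qed.

Lemma adj_sym : symmetric adj.
Proof. by move=> u w; rewrite /gi_adj /= spoke_sym layer_sym. Qed.

Lemma gi_autP (p : {perm gi_vertex n t}) :
  reflect (forall u w, adj (p u) (p w) = adj u w) (p \in G).
Proof. exact: graph_autP. Qed.

Lemma layer_jump s v : @gi_layer n t J (s, v) (s, v + jump s)%R.
Proof. by rewrite /gi_layer /= !eqxx. Qed.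

Lemma adj_jump s v : adj (s, v) (s, v + jump s)%R.
Proof. by rewrite /gi_adj /= layer_jump orbT. Qed.

Lemma adj_spoke s s' v : s != s' -> adj (s, v) (s', v).
Proof. by move=> h; rewrite /gi_adj /gi_spoke /= h eqxx. Qed.

Lemma gcd_dvd_n : gi_gcd n J %| n.
Proof. exact: dvdn_gcdl. Qed.

Lemma gcd_dvd_jump j : j \in J -> gi_gcd n J %| j.
Proof.
move=> Jj; apply: dvdn_trans (dvdn_gcdr _ _) _.
by rewrite (big_rem j) //= dvdn_gcdl.
Qed.

Lemma gcd_gt0 : 0 < gi_gcd n J.
Proof. by rewrite gcdn_gt0 (ltn_trans _ hn). Qed.

(** Reachability and affineness of column maps both pass from two step lengths to
    their gcd; this induction carries them from [n] and the jumps to their gcd. *)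
Lemma gi_gcd_ind (P : nat -> Prop) :
  P n -> P 0 -> (forall j, j \in J -> P j) ->
  (forall a b, P a -> P b -> P (gcdn a b)) -> P (gi_gcd n J).
Proof.
move=> Pn P0 PJ Pgcd; apply: (Pgcd) => //.
by rewrite big_seq; apply: big_ind.
Qed.

(** Bezout coefficients turn two step lengths between connected columns into a
    step by their gcd. *)
Lemma connected_gcd1 : 0 < t -> gi_gcd n J = 1 -> graph_connected adj.
Proof.
move=> t0 g1.
have csym : connect_sym adj := sym_connect_sym adj_sym.
have spk s s' v : connect adj (s, v) (s', v).
  by case: (eqVneq s s') => [->|h]; [exact: connect0 | exact/connect1/adj_spoke].
pose P c := forall v s s', connect adj (s, v) (s', v + c%:R)%R.
have P0 : P 0 by move=> v s s'; rewrite GRing.addr0.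
have PD a b : P a -> P b -> P (a + b).
  move=> Pa Pb v s s'; rewrite GRing.natrD GRing.addrA.
  exact: connect_trans (Pa v s s') (Pb _ _ _).
have PM k a : P a -> P (k * a).
  by move=> Pa; elim: k => [|k IH]; rewrite ?mul0n // mulSn; apply: PD.
have P1 : P 1.
  rewrite -g1; apply: gi_gcd_ind => //.
  - by move=> v s s'; rewrite Zn_nat_n // GRing.addr0.
  - move=> j /tnthP[s0 ->] v s s'; apply: connect_trans (spk s s0 v) _.
    exact: connect_trans (connect1 (adj_jump s0 v)) (spk _ _ _).
  move=> a b Pa Pb; case: (posnP a) => [->|a0]; first by rewrite gcd0n.
  have [u w Eu _] := egcdnP b a0 => v s s'.
  apply: connect_trans (PM u _ Pa v s s') _.
  by rewrite csym Eu addnC GRing.natrD GRing.addrA; apply: PM.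
move=> [s v] [s' v'].
have -> : v' = (v + ((v' - v : 'Z_n)%R : nat)%:R)%R.
  by rewrite Zn_natr GRing.addrC GRing.subrK.
by rewrite -[X in (X%:R)%R]muln1; apply: PM.
Qed.

(** Divisibility of the second coordinate by the gcd is preserved along edges, so
    columns 0 and 1 are connected only if the gcd is 1. *)
Lemma gcd1_connected : 0 < t -> graph_connected adj -> gi_gcd n J = 1.
Proof.
move=> t0 con; set g := gi_gcd n J.
have gadd (v : 'Z_n) j : g %| j -> (g %| (v + j%:R)%R) = (g %| v).
  move=> gj; rewrite Zn_add_natr // val_Zp_nat // /dvdn modn_dvdm ?gcd_dvd_n //.
  exact: dvdn_addl.
pose a := [pred x : gi_vertex n t | g %| x.2].
have cla : closed adj a.
  have one s v : (g %| (v + jump s)%R) = (g %| v).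
    exact/gadd/gcd_dvd_jump/mem_tnth.
  move=> [s v] [s' v'] /orP[/andP[_ /eqP /= E]|/andP[/eqP /= <- /orP[]/eqP /= E]];
    rewrite !inE /= ?E ?one //.
  by rewrite -[v in LHS](GRing.subrK (jump s)) one.
have := closed_connect cla (con (Ordinal t0, 0%R) (Ordinal t0, 1%R)).
rewrite !inE dvdn0 /= => /esym.
by rewrite Zp_cast // modn_small // dvdn1 => /eqP.
Qed.

End GIBasics.

(** * The wreath product decomposition *)

Section Copies.
Local Open Scope nat_scope.
Variables (n t : nat) (J : t.-tuple nat).
Hypothesis hn : 2 < n.
Hypothesis ht : 0 < t.
Hypothesis hJ : forall j, j \in J -> 0 < j < n /\ j.*2 <> n.

Local Notation d := (gi_gcd n J).
Local Notation m := (n %/ d).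
Local Notation J' := (gi_quo n J).

Let d_gt0 : 0 < d. Proof. exact: gcd_gt0. Qed.
Let nE : n = d * m. Proof. by rewrite mulnC divnK // gcd_dvd_n. Qed.

Lemma quo_jump s : tnth J s = d * tnth J' s.
Proof. by rewrite tnth_map mulnC divnK // gcd_dvd_jump ?mem_tnth. Qed.

Lemma quo_spec j : j \in J' -> 0 < j < m /\ j.*2 <> m.
Proof.
case/tnthP=> s ->; have := hJ (mem_tnth s J); rewrite quo_jump.
move: (tnth _ _) nE d_gt0 => k; move: (gi_gcd n J) (n %/ _) => D M -> D0.
rewrite muln_gt0 D0 ltn_pmul2l //= => -[-> kM]; split=> // E.
by apply: kM; rewrite doubleMr E.
Qed.

Lemma quo_gt2 : 2 < m.
Proof.
have s : 'I_t := Ordinal ht.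
have [/andP[? ?] ?] := quo_spec (mem_tnth s J'); lia.
Qed.

Lemma quo_gcd1 : gi_gcd m J' = 1.
Proof.
apply/eqP; rewrite -(eqn_pmul2l d_gt0) muln1 {2}/gi_gcd; apply/eqP.
rewrite muln_gcdr -nE [in RHS]/gi_gcd big_map; congr gcdn.
rewrite (big_morph (muln d) (id1 := 0) (op1 := gcdn)) ?muln0 //; last first.
  by move=> a b; rewrite muln_gcdr.
by rewrite !big_seq; apply: eq_bigr => j Jj; rewrite mulnC divnK ?gcd_dvd_jump.
Qed.

Lemma mod_copies (i k : 'I_d) a b :
  (i + d * a == k + d * b %[mod n]) = (i == k) && (a == b %[mod m]).
Proof. by rewrite -eqn_mod_mixed -nE. Qed.

(** Copy [i] consists of the columns congruent to [i] modulo [d]. *)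
Definition copy_vertex (x : gi_vertex m t * 'I_d) : gi_vertex n t :=
  (x.1.1, ((x.2 + d * x.1.2)%:R)%R).

Definition vertex_copy (v : gi_vertex n t) : gi_vertex m t * 'I_d :=
  ((v.1, ((v.2 %/ d)%:R)%R), Ordinal (ltn_pmod v.2 d_gt0)).

Let hn1 : 1 < n. Proof. exact: ltnW. Qed.
Let hm1 : 1 < m. Proof. exact/ltnW/quo_gt2. Qed.

Lemma vertex_copyK : cancel vertex_copy copy_vertex.
Proof.
case=> s v; rewrite /copy_vertex /=; congr (_, _).
rewrite val_Zp_nat // (@modn_small (v %/ d)); last first.
  by rewrite ltn_divLR // mulnC -nE ltn_Zn.
by rewrite addnC mulnC -divn_eq Zn_natr.
Qed.

Lemma copy_vertex_inj : injective copy_vertex.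
Proof.
case=> [[s v] i] [[s' v'] i'] [-> /eqP].
rewrite Zn_nat_eq // mod_copies => /andP[/eqP-> /eqP E]; congr (_, _, _).
by apply: val_inj; rewrite /= !modn_small ?ltn_Zn // in E.
Qed.

Lemma copy_vertexK : cancel copy_vertex vertex_copy.
Proof. by move=> x; apply: copy_vertex_inj; rewrite vertex_copyK. Qed.

Lemma adj_copy x i y k :
  gi_adj n J (copy_vertex (x, i)) (copy_vertex (y, k)) =
  (i == k) && gi_adj m J' x y.
Proof.
case: x y => s v [s' v'].
have E (a b : 'Z_m) c : ((a + c%:R)%R == b) = (a + c == b %[mod m]).
  by rewrite -[b]Zn_natr Zn_add_natr // Zn_nat_eq // Zn_natr.
have step (a b : 'Z_m) (l h : 'I_d) :
    (((l + d * a)%:R + gi_jump n J s)%R == ((h + d * b)%:R)%R :> 'Z_n) =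
    (l == h) && ((a + gi_jump m J' s)%R == b).
  by rewrite -GRing.natrD quo_jump -addnA -mulnDr Zn_nat_eq // mod_copies E.
rewrite /gi_adj /gi_spoke /gi_layer /= !(eq_sym _ (_ + _)%R) step.
rewrite !GRing.subr_eq !(eq_sym _ (_ + gi_jump _ _ _)%R) step.
rewrite Zn_nat_eq // mod_copies (eq_sym k i) !modn_small ?ltn_Zn //.
rewrite -(inj_eq val_inj) /=.
by case: (i == k); rewrite ?andbF //=.
Qed.

Lemma gi_aut_wreath :
  gi_aut n J \isog [set: wreath [subg gi_aut m J']%type d] /\
  #|gi_aut n J| = (d`! * #|gi_aut m J'| ^ d)%N.
Proof.
have con : graph_connected (gi_adj m J').
  by apply: connected_gcd1 quo_gcd1 => //; apply: quo_gt2.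
pose w0 : gi_vertex m t := (Ordinal ht, 0%R).
split.
  exact: (graph_aut_wreath w0 copy_vertexK vertex_copyK adj_copy con).
exact: (card_graph_aut_wreath w0 copy_vertexK vertex_copyK adj_copy con).
Qed.

End Copies.

(** * Rotations, layer permutations and edge orbits *)

Section Rotation.
Variables (n t : nat) (J : t.-tuple nat).

Lemma rotE (x : gi_vertex n t) : gi_rot n t x = (x.1, x.2 + 1)%R.
Proof. by rewrite permE. Qed.

Lemma rotX k (x : gi_vertex n t) : (gi_rot n t ^+ k) x = (x.1, x.2 + k%:R)%R.
Proof.
elim: k => [|k IH]; first by rewrite expg0 perm1 GRing.addr0 -surjective_pairing.
by rewrite expgSr permM IH rotE -GRing.addrA GRing.natr1.
Qed.

Lemma rotXz (c : 'Z_n) (x : gi_vertex n t) :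
  (gi_rot n t ^+ c) x = (x.1, x.2 + c)%R.
Proof. by rewrite rotX natr_Zp. Qed.

Lemma rot_aut : gi_rot n t \in gi_aut n J.
Proof.
apply/graph_autP=> -[s v] [s' w]; rewrite !rotE /gi_adj /gi_spoke /gi_layer /=.
by rewrite !(GRing.addrAC _ 1%R) !(inj_eq (GRing.addIr _)).
Qed.

Section LayerPerm.
Variable sg : 'S_t.

Definition relayer_fun (x : gi_vertex n t) : gi_vertex n t := (sg x.1, x.2).

Lemma relayer_inj : injective relayer_fun.
Proof. by move=> [s v] [s' v'] [/perm_inj-> ->]. Qed.

Definition relayer : {perm gi_vertex n t} := perm relayer_inj.

Lemma relayerE x : relayer x = (sg x.1, x.2).
Proof. by rewrite permE. Qed.

Lemma relayer_aut : (forall s, gi_jump n J (sg s) = gi_jump n J s) ->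
  relayer \in gi_aut n J.
Proof.
move=> sgJ; apply/graph_autP=> -[s v] [s' w].
by rewrite !relayerE /gi_adj /gi_spoke /gi_layer /= sgJ (inj_eq perm_inj).
Qed.

End LayerPerm.
End Rotation.

Section EdgeOrbits.
Variables (n t : nat) (J : t.-tuple nat).
Hypothesis hn : 2 < n.
Hypothesis hJ : forall j, j \in J -> 0 < j < n /\ j.*2 <> n.

Local Notation jump := (gi_jump n J).
Local Notation adj := (gi_adj n J).
Local Notation spoke := (@gi_spoke n t).
Local Notation layer := (@gi_layer n t J).
Local Notation G := (gi_aut n J).
Implicit Types (E F : {set gi_vertex n t}) (p : {perm gi_vertex n t}).

Definition same_orbit E F := exists2 p, p \in G & p @: E = F.

Lemma same_orbit_sym E F : same_orbit E F -> same_orbit F E.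
Proof.
case=> p Gp <-; exists p^-1; first by rewrite groupV.
rewrite -imset_comp (eq_imset (g := id)) ?imset_id // => x /=.
by rewrite permK.
Qed.

Lemma same_orbit_trans E F H : same_orbit E F -> same_orbit F H -> same_orbit E H.
Proof.
case=> p Gp <- [q Gq <-]; exists (p * q); first by rewrite groupM.
by rewrite -imset_comp; apply: eq_imset => x; rewrite permM.
Qed.

Lemma imset2_perm p x y : p @: [set x; y] = [set p x; p y].
Proof. by rewrite imsetU !imset_set1. Qed.

Lemma same_orbit_perm p x y : p \in G ->
  same_orbit [set x; y] [set p x; p y].
Proof. by move=> Gp; exists p; rewrite ?imset2_perm. Qed.

Lemma same_orbit_spoke s s' v w :
  same_orbit [set (s, v); (s', v)] [set (s, w); (s', w)].
Proof.
have [|p Gp E] := @same_orbit_perm (gi_rot n t ^+ (w - v)%R) (s, v) (s', v).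
  exact/groupX/rot_aut.
by exists p; rewrite // E !rotXz /= GRing.addrC GRing.subrK.
Qed.

Lemma same_orbit_layer s v w :
  same_orbit [set (s, v); (s, v + jump s)%R] [set (s, w); (s, w + jump s)%R].
Proof.
have [|p Gp E] :=
    @same_orbit_perm (gi_rot n t ^+ (w - v)%R) (s, v) (s, v + jump s)%R.
  exact/groupX/rot_aut.
exists p; rewrite // E !rotXz /= GRing.addrAC.
by have -> : (v + (w - v) = w)%R by rewrite GRing.addrC GRing.subrK.
Qed.

Lemma layer_edge u w : layer u w ->
  exists v, [set u; w] = [set (u.1, v); (u.1, v + jump u.1)%R].
Proof.
case: u w => s v [s' w] /andP[/= /eqP<- /orP[]/eqP ->]; first by exists v.
by exists (v - jump s)%R; rewrite GRing.subrK setUC.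
Qed.

Lemma edge_transitiveP E0 :
  (forall s s' v, s != s' -> same_orbit E0 [set (s, v); (s', v)]) ->
  (forall s v, same_orbit E0 [set (s, v); (s, v + jump s)%R]) ->
  edge_transitive adj.
Proof.
move=> hS hL.
have h E : E \in graph_edges adj -> same_orbit E0 E.
  case/imsetP=> [[u w]]; rewrite inE /= => /orP[|/layer_edge[v ->] ->]; last exact: hL.
  by case: u w => s v [s' w] /andP[/= ss /eqP<-] ->; apply: hS.
move=> E F /h hE /h hF.
exact: same_orbit_trans (same_orbit_sym hE) hF.
Qed.

Lemma adj_same_layer u w : adj u w -> u.1 = w.1 -> layer u w.
Proof. by case/orP=> // /andP[/eqP h _] /h. Qed.

Lemma layer_neq u w : layer u w -> u.2 != w.2.
Proof.
case: u w => s v [s' w] /andP[/= _] h; apply/eqP=> E; move: h; rewrite -E.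
rewrite -{1}(GRing.addr0 v) -{3}(GRing.addr0 v) !(inj_eq (GRing.addrI _)).
by rewrite !(eq_sym 0%R) GRing.oppr_eq0 orbb (negPf (jump_neq0 hn hJ s)).
Qed.

(** Spokes cannot close a triangle on a layer edge, since they keep the second
    coordinate. *)
Lemma common_neighbour u w x : layer u w -> adj x u -> adj x w -> x.1 = u.1.
Proof.
move=> luw xu xw; have u1 : u.1 = w.1 by case/andP: luw => /eqP.
apply/eqP; apply: contraT => xu1; case/negP: (layer_neq luw).
case/orP: xu => [/andP[_ /eqP<-]|/andP[/eqP E _]]; last by rewrite E eqxx in xu1.
by case/orP: xw => [/andP[_ /eqP<-]//|/andP[/eqP E _]]; rewrite u1 E eqxx in xu1.
Qed.

(** The third vertex can only be [v - j], and it is adjacent to [v + j] only when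
    [3 j = 0], since [j] and [2 j] are nonzero. *)
Lemma triangle_jump x s v : adj x (s, v) -> adj x (s, v + jump s)%R ->
  (jump s + jump s + jump s = 0)%R.
Proof.
move=> xu xw; have := common_neighbour (layer_jump J s v) xu xw.
case: x xu xw => s' x xu xw /= ss; subst s'.
have /andP[_ /= h1] : layer (s, x) (s, v) by apply: adj_same_layer.
have /andP[_ /= h2] : layer (s, x) (s, v + jump s)%R by apply: adj_same_layer.
have j0 := jump_neq0 hn hJ s; have jj := jump2_neq0 hn hJ s.
move: (jump s) j0 jj h1 h2 => j j0 jj.
case/orP=> /eqP-> /orP[]; rewrite -GRing.subr_eq0.
- have -> : (x + j + j - (x + j) = j)%R by ring.
  by rewrite (negPf j0).
- have -> : (x + j + j - (x - j) = j + j + j)%R by ring.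
  by move/eqP.
- have -> : (x - j + j - (x + j) = - j)%R by ring.
  by rewrite GRing.oppr_eq0 (negPf j0).
have -> : (x - j + j - (x - j) = j)%R by ring.
by rewrite (negPf j0).
Qed.

End EdgeOrbits.

(** * Automorphisms preserve the spokes *)

Lemma exists_fresh t (a b : 'I_t) : 2 < t -> exists2 c, c != a & c != b.
Proof.
move=> t2; have : ~~ ([set: 'I_t] \subset [set a; b]).
  apply: contraL t2 => /subset_leq_card; rewrite cardsT card_ord -leqNgt => h.
  by apply: leq_trans h _; rewrite cards2; case: (a != b).
by case/subsetPn=> c _; rewrite !inE negb_or => /andP[ca cb]; exists c.
Qed.

Section SpokesPreserved.
Variables (n t : nat) (J : t.-tuple nat).
Hypothesis hn : 2 < n.
Hypothesis hJ : forall j, j \in J -> 0 < j < n /\ j.*2 <> n.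
Hypothesis std : gi_standard n J.

Local Notation jump := (gi_jump n J).
Local Notation adj := (gi_adj n J).
Local Notation spoke := (@gi_spoke n t).
Local Notation layer := (@gi_layer n t J).
Local Notation G := (gi_aut n J).
Implicit Types (E F : {set gi_vertex n t}) (p : {perm gi_vertex n t}).

Let hn1 : 1 < n. Proof. exact: ltnW. Qed.

Lemma std_bounds s : (0 < (tnth J s).*2 < n)%N.
Proof. by case/andP: std => /all_tnthP /(_ s). Qed.

Lemma jump_pm_inj s s' : eq_pm (jump s) (jump s') -> tnth J s = tnth J s'.
Proof.
have := std_bounds s; have := std_bounds s'.
rewrite /eq_pm /gi_jump; move: (tnth J s) (tnth J s') => i j bj bi.
case/orP.
  by rewrite Zn_nat_eq // !modn_small; [move/eqP| lia | lia].
rewrite -GRing.subr_eq0 GRing.opprK -GRing.natrD -(GRing.mulr0n 1%R).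
by rewrite Zn_nat_eq // mod0n modn_small; lia.
Qed.

Lemma jump3_eq s : (jump s + jump s + jump s = 0)%R -> (3 * tnth J s = n)%N.
Proof.
have := std_bounds s; rewrite /gi_jump; move: (tnth J s) => j bj.
rewrite -!GRing.natrD -(GRing.mulr0n 1%R) => /eqP.
rewrite Zn_nat_eq // mod0n => /dvdnP[k E].
have k0 : (0 < k)%N by case: k E; lia.
have k2 : (k < 2)%N by rewrite -(ltn_pmul2r (ltnW hn1)) -E; lia.
have k1 : k = 1%N by lia.
by move: E; rewrite k1; lia.
Qed.

Lemma triangle_layer x u w :
  layer u w -> adj x u -> adj x w -> (jump u.1 + jump u.1 + jump u.1 = 0)%R.
Proof.
case: u w => s v [s' w] /andP[/= /eqP<- /orP[]/eqP ->].
  exact: (triangle_jump hn hJ).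
move=> h1 h2; apply: (@triangle_jump n t J hn hJ x s (v - jump s)%R) => //.
by rewrite GRing.subrK.
Qed.

(** With constant [J] the layers can be permuted freely, so all spokes lie in one
    orbit and all layer edges in one orbit; the given automorphism merges the two. *)
Lemma constant_edge_transitive p u w :
  (forall s s', jump s = jump s') ->
  p \in G -> spoke u w -> layer (p u) (p w) -> edge_transitive adj.
Proof.
move=> cst Gp uw luw; have Guw := same_orbit_perm u w Gp.
case: u w uw luw Guw => a v [b v'] /andP[/= ab /eqP<-] luw Guw.
apply: (@edge_transitiveP n t J [set (a, v); (b, v)]) => [s s' y ss|s y].
  apply: same_orbit_trans (same_orbit_spoke _ _ _ _ y) _.
  pose b1 := tperm a s b; have b1s : b1 != s.
    by rewrite /b1 -{2}(tpermL a s) (inj_eq perm_inj) eq_sym.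
  pose sg := tperm a s * tperm b1 s'.
  have -> : [set (s, y); (s', y)] =
      [set relayer n sg (a, y); relayer n sg (b, y)].
    rewrite !relayerE !permM /= tpermL tpermD //; last by rewrite eq_sym.
    by rewrite -/b1 tpermL.
  by apply/same_orbit_perm/relayer_aut => r; apply: cst.
apply: same_orbit_trans Guw _.
have [z ->] := layer_edge luw; set r := (p _).1.
apply: same_orbit_trans (same_orbit_layer _ _ _ y) _.
have -> : [set (s, y); (s, y + jump s)%R] =
    [set relayer n (tperm r s) (r, y); relayer n (tperm r s) (r, y + jump r)%R].
  by rewrite !relayerE /= tpermL (cst r s).
by apply/same_orbit_perm/relayer_aut => q; apply: cst.
Qed.

(** Both ends of the spoke land in the same layer, whose edges all belong to the
    orbit [E0] of the spokes; so the edges of either layer at that spoke are mapped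
    into the orbit. *)
Lemma two_layers_edge_transitive p u w : t = 2 ->
  p \in G -> spoke u w -> layer (p u) (p w) -> edge_transitive adj.
Proof.
move=> t2 Gp uw luw; have Guw := same_orbit_sym (same_orbit_perm u w Gp).
case: u w uw luw Guw => a v [b v'] /andP[/= ab /eqP<-] luw Guw.
have only2 c : (c == a) || (c == b).
  have lt2 (x : 'I_t) : (x < 2)%N by rewrite -[X in (_ < X)%N]t2.
  by move: (lt2 a) (lt2 b) (lt2 c) ab; rewrite -!val_eqE /=; lia.
set E0 := [set p (a, v); p (b, v)] in Guw *.
have hS s s' y : s != s' -> same_orbit J E0 [set (s, y); (s', y)].
  move=> ss; apply: same_orbit_trans (same_orbit_spoke _ _ _ v y).
  case/orP: (only2 s) ss => /eqP->; case/orP: (only2 s') => /eqP->;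
    by rewrite ?eqxx // setUC.
have hL y : same_orbit J E0
    [set ((p (a, v)).1, y); ((p (a, v)).1, y + jump (p (a, v)).1)%R].
  have [z Ez] := layer_edge luw; rewrite [E0]Ez; exact: same_orbit_layer.
apply: (edge_transitiveP hS) => r y.
apply: same_orbit_trans (same_orbit_layer _ _ v y).
apply: same_orbit_trans (same_orbit_sym (same_orbit_perm _ _ Gp)).
have pr : (p (r, v)).1 = (p (a, v)).1.
  by case/orP: (only2 r) => /eqP-> //; case/andP: luw => /eqP.
have : adj (p (r, v)) (p (r, v + jump r)%R).
  by rewrite (gi_autP _ _ Gp) adj_jump.
case/orP=> [|/layer_edge[z ->]]; last by rewrite pr.
by case: (p _) (p _) => s z [s' z'] /andP[/= ss /eqP<-]; apply: hS.
Qed.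

(** A third vertex of the column must land in the same layer as the image of the
    spoke, which makes this layer, and then by pulling back every layer, a union
    of triangles. *)
Lemma three_layers_edge_transitive p u w : (2 < t)%N ->
  p \in G -> spoke u w -> layer (p u) (p w) -> edge_transitive adj.
Proof.
move=> t2 Gp uw luw; apply: constant_edge_transitive (Gp) (uw) (luw).
have pA := gi_autP _ _ Gp.
case: u w uw luw => a v [b v'] /andP[/= ab /eqP<-] luw.
have in_layer c : c != a -> c != b -> (p (c, v)).1 = (p (a, v)).1.
  by move=> ca cb; apply: (common_neighbour hn hJ luw); rewrite pA adj_spoke.
have [c ca cb] := exists_fresh a b t2.
set s0 := (p (a, v)).1 in in_layer.
have j3 : (jump s0 + jump s0 + jump s0 = 0)%R.
  by apply: (@triangle_layer (p (c, v)) _ _ luw); rewrite pA adj_spoke.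
have all_s0 r : (p (r, v)).1 = s0.
  case: (eqVneq r a) => [->//|ra]; case: (eqVneq r b) => [->|rb].
    by case/andP: luw => /eqP.
  exact: in_layer.
(* A spoke is completed by a third layer; as [3 j = 0], a layer edge from [x] to
   [x + j] is completed by [x - j]. *)
have tri x y : x.1 = s0 -> adj x y -> exists2 z, adj z x & adj z y.
  case: x => s x /= ->; case: y => s' y /orP[/andP[/= ss /eqP<-]|].
    have [r rs rs'] := exists_fresh s0 s' t2.
    by exists (r, x); apply: adj_spoke.
  have [E1 E2] : (jump s0 + jump s0 = - jump s0 /\
                  - jump s0 - jump s0 = jump s0)%R.
    split; apply/eqP; rewrite -GRing.subr_eq0 ?GRing.opprK ?j3 //.
    by rewrite -!GRing.opprD j3 GRing.oppr0.
  case/andP=> /= /eqP<- /orP[]/eqP->.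
    exists (s0, x - jump s0)%R; rewrite /gi_adj /gi_layer /= !eqxx /= ?orbT //.
      by rewrite GRing.subrK eqxx !orbT.
    by rewrite -(GRing.addrA x _ (- _)%R) E2 eqxx !orbT.
  exists (s0, x + jump s0)%R; rewrite /gi_adj /gi_layer /= !eqxx /= ?orbT //.
    by rewrite GRing.addrK eqxx !orbT.
  by rewrite -(GRing.addrA x (jump s0) (jump s0)) E1 eqxx !orbT.
have all3 r : (3 * tnth J r = n)%N.
  apply: jump3_eq.
  have [|z z1 z2] := tri _ (p (r, v + jump r)%R) (all_s0 r).
    by rewrite pA adj_jump.
  apply: (@triangle_jump n t J hn hJ (p^-1 z) r v).
    by rewrite -pA permKV.
  by rewrite -pA permKV.
move=> s s'; rewrite /gi_jump; have := all3 s; have := all3 s'.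
by move: (tnth J s) (tnth J s') => i j Ej Ei; have -> : i = j by lia.
Qed.

Lemma aut_spoke p u w : ~ edge_transitive adj ->
  p \in G -> spoke u w -> spoke (p u) (p w).
Proof.
move=> nET Gp uw; apply: contraT => nsp; case: nET.
have luw : layer (p u) (p w).
  have := gi_autP _ _ Gp u w; rewrite {2}/gi_adj /= uw.
  by case/orP=> // h; rewrite h in nsp.
have t1 : (1 < t)%N.
  case: u w uw {nsp luw} => a v [b v'] /andP[/= + _].
  rewrite -val_eqE /= => ab; have := ltn_ord a; have := ltn_ord b.
  by move: ab; move: (a : nat) (b : nat); lia.
case: (ltngtP t 2) => [|t2|t2]; first by rewrite ltnNge t1.
  exact: three_layers_edge_transitive t2 Gp uw luw.
exact: two_layers_edge_transitive t2 Gp uw luw.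
Qed.

End SpokesPreserved.

(** * Automorphisms act affinely on the columns *)

Section AffineAlong.
Variable R : comNzRingType.
Local Open Scope ring_scope.

(** The slope [E] may vary with the coset of [v] modulo the multiples of [d]. *)
Definition affine_along (f : R -> R) (d : R) :=
  forall v, exists E, forall x, f (v + x * d) = f v + x * E.

(** Along the two directions [f] is affine separately, so its value at the
    coefficients [(x, y)] is bilinear up to constants, with a mixed coefficient [C].
    Since [q (p g) = p (q g)], the coefficients [(q, 0)] and [(0, p)] give the same
    element; shifting this relation shows [q C = p C = 0], whence [C = 0]. *)
Lemma affine_along_bezout f p q g a b :
  a * p + b * q = 1 ->
  affine_along f (p * g) -> affine_along f (q * g) -> affine_along f g.
Proof.
move=> bez fp fq v; have [E0 hE0] := fp v; have [B0 hB0] := fq v.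
have [B1 hB1] := fq (v + 1 * (p * g)); pose C := B1 - B0.
have F x y : f (v + (x * p + y * q) * g) = f v + (x * E0 + y * B0 + x * y * C).
  have [Ey hEy] := fp (v + y * (q * g)).
  have e1 := hEy 1; have e2 := hEy x; have e3 := hB1 y.
  have -> : v + (x * p + y * q) * g = v + y * (q * g) + x * (p * g) by ring.
  rewrite e2 hB0.
  have -> : Ey = E0 + y * C.
    have s : v + y * (q * g) + 1 * (p * g) = v + 1 * (p * g) + y * (q * g).
      by ring.
    rewrite s e3 hE0 hB0 in e1.
    apply: (GRing.addrI (f v + y * B0)).
    by rewrite -[Ey]GRing.mul1r -e1 /C; ring.
  by ring.
have qp : q * p + 0 * q = 0 * p + p * q by ring.
have := F q 0; rewrite qp F => /GRing.addrI e0.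
have e : q * E0 = p * B0.
  have -> : q * E0 = q * E0 + 0 * B0 + q * 0 * C by ring.
  by rewrite -e0; ring.
have qp1 : q * p + 1 * q = 0 * p + (p + 1) * q by ring.
have := F q 1; rewrite qp1 F => /GRing.addrI e1.
have qC : q * C = 0.
  apply: (GRing.addrI (q * E0 + 1 * B0)).
  have -> : q * E0 + 1 * B0 + q * C = q * E0 + 1 * B0 + q * 1 * C by ring.
  by rewrite -e1 e; ring.
have qp2 : (1 + q) * p + 0 * q = 1 * p + p * q by ring.
have := F (1 + q) 0; rewrite qp2 F => /GRing.addrI e2.
have pC : p * C = 0.
  apply: (GRing.addrI (1 * E0 + p * B0)).
  have -> : 1 * E0 + p * B0 + p * C = 1 * E0 + p * B0 + 1 * p * C by ring.
  by rewrite e2 -e; ring.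
have C0 : C = 0.
  have -> : C = a * (p * C) + b * (q * C) by rewrite -[LHS]GRing.mul1r -bez; ring.
  by rewrite pC qC; ring.
exists (a * E0 + b * B0) => x.
have -> : v + x * g = v + ((x * a) * p + (x * b) * q) * g.
  by rewrite -[x in LHS]GRing.mulr1 -bez; ring.
by rewrite F C0; ring.
Qed.

Lemma affine_along_gcd f (i j : nat) :
  affine_along f i%:R -> affine_along f j%:R -> affine_along f (gcdn i j)%:R.
Proof.
move=> fi fj; case: (posnP i) => [->|i0]; first by rewrite gcd0n.
have [k l Ek _] := egcdnP j i0; set g := gcdn i j in Ek *.
have g0 : (0 < g)%N by rewrite gcdn_gt0 i0.
have iE : (i = i %/ g * g)%N by rewrite divnK // dvdn_gcdl.
have jE : (j = j %/ g * g)%N by rewrite divnK // dvdn_gcdr.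
have E1 : (k * (i %/ g) = l * (j %/ g) + 1)%N.
  by apply/eqP; rewrite -(eqn_pmul2r g0) mulnDl -!mulnA -iE -jE mul1n Ek.
apply: (@affine_along_bezout f (i %/ g)%:R (j %/ g)%:R _ k%:R (- l%:R)).
- by rewrite -GRing.natrM E1 GRing.natrD GRing.natrM; ring.
- by rewrite -GRing.natrM -iE.
- by rewrite -GRing.natrM -jE.
Qed.

End AffineAlong.

Section ColumnMap.
Variables (n t : nat) (J : t.-tuple nat).
Hypothesis hn : 2 < n.
Hypothesis ht : 0 < t.
Hypothesis hJ : forall j, j \in J -> 0 < j < n /\ j.*2 <> n.
Hypothesis std : gi_standard n J.
Hypothesis con : graph_connected (gi_adj n J).
Hypothesis nET : ~ edge_transitive (gi_adj n J).

Local Notation jump := (gi_jump n J).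
Local Notation adj := (gi_adj n J).
Local Notation spoke := (@gi_spoke n t).
Local Notation layer := (@gi_layer n t J).
Local Notation G := (gi_aut n J).
Implicit Types (p : {perm gi_vertex n t}).

Lemma aut_spokeE p u w : p \in G -> spoke (p u) (p w) = spoke u w.
Proof.
move=> Gp; apply/idP/idP; last exact: (aut_spoke hn hJ std nET Gp).
have Gp' : p^-1 \in G by rewrite groupV.
by move/(aut_spoke hn hJ std nET Gp'); rewrite !permK.
Qed.

Lemma not_spoke_layer u w : layer u w -> spoke u w = false.
Proof. by case/andP=> /eqP E _; rewrite /gi_spoke /= E eqxx. Qed.

Lemma aut_layer p u w : p \in G -> layer u w -> layer (p u) (p w).
Proof.
move=> Gp luw; have : adj (p u) (p w) by rewrite (gi_autP _ _ Gp) /gi_adj /= luw orbT.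
by rewrite /gi_adj /= aut_spokeE // not_spoke_layer.
Qed.

Lemma aut_column p s s' v : p \in G -> (p (s, v)).2 = (p (s', v)).2.
Proof.
move=> Gp; case: (eqVneq s s') => [->//|ss].
have := aut_spokeE (s, v) (s', v) Gp.
by rewrite {2}/gi_spoke /= ss eqxx => /andP[_ /eqP].
Qed.

Lemma eq_pm_sym (x y : 'Z_n) : eq_pm x y = eq_pm y x.
Proof. by rewrite /eq_pm (eq_sym y) (eq_sym y) GRing.eqr_oppLR. Qed.

(** The image of a line cannot turn back, because three consecutive vertices of the
    line are distinct; so every step is the same [E]. *)
Lemma aut_line p s v : p \in G -> exists2 E, eq_pm (jump (p (s, v)).1) E &
  forall k, p (s, v + jump s *+ k)%R = ((p (s, v)).1, (p (s, v)).2 + E *+ k)%R.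
Proof.
move=> Gp; have step w : exists2 E, eq_pm (jump (p (s, w)).1) E &
    p (s, w + jump s)%R = ((p (s, w)).1, (p (s, w)).2 + E)%R.
  have := aut_layer Gp (layer_jump J s w).
  case: (p (s, w + _)%R) => r y /andP[/= /eqP<- /orP[]/eqP->].
    by exists (jump (p (s, w)).1); rewrite // /eq_pm eqxx.
  by exists (- jump (p (s, w)).1)%R; rewrite // /eq_pm GRing.opprK eqxx orbT.
have [E pmE E1] := step v; exists E => //.
set r := (p (s, v)).1 in pmE E1 *; set c := (p (s, v)).2 in E1 *.
suff h k : p (s, v + jump s *+ k)%R = (r, c + E *+ k)%R /\
    p (s, v + jump s *+ k.+1)%R = (r, c + E *+ k.+1)%R by move=> k; case: (h k).
elim: k => [|k [IH0 IH1]].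
  by rewrite !GRing.mulr0n !GRing.addr0 !GRing.mulr1n -surjective_pairing.
split=> //; have [F pmF F1] := step (v + jump s *+ k.+1)%R.
rewrite GRing.mulrSr GRing.addrA F1 IH1 /= [in RHS]GRing.mulrSr GRing.addrA.
rewrite IH1 /= in pmF.
case: (eqVneq E F) => [->//|EF].
have {EF} FE : F = (- E)%R.
  case/orP: pmE EF => /eqP e1; case/orP: pmF => /eqP e2; rewrite e1 in e2 => EF.
  - by rewrite e2 eqxx in EF.
  - by rewrite e2 GRing.opprK.
  - by rewrite e2.
  - by rewrite (GRing.oppr_inj e2) eqxx in EF.
have /perm_inj/(congr1 snd)/= /eqP :
    p (s, v + jump s *+ k.+1 + jump s)%R = p (s, v + jump s *+ k)%R.
  by rewrite F1 IH0 IH1 /= FE GRing.mulrSr GRing.addrA GRing.addrK.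
rewrite -(GRing.subr_eq0 _ (v + _)%R) (GRing.mulrSr (jump s)).
have -> : (v + (jump s *+ k + jump s) + jump s - (v + jump s *+ k) =
           jump s + jump s)%R by ring.
by rewrite (negPf (jump2_neq0 hn hJ s)).
Qed.

Lemma aut_affine p : p \in G ->
  exists c a, forall x, (p x).2 = (c + a * x.2)%R.
Proof.
move=> Gp; pose s0 := Ordinal ht; pose f v := (p (s0, v)).2.
have aff : affine_along f ((gi_gcd n J)%:R)%R.
  apply: (@gi_gcd_ind n t J (fun d => affine_along f d%:R)%R).
  - move=> v; exists 0%R => x.
    by rewrite Zn_nat_n ?(ltnW hn) // !GRing.mulr0 !GRing.addr0.
  - by move=> v; exists 0%R => x; rewrite !GRing.mulr0 !GRing.addr0.
  - move=> j /tnthP[s ->] v; have [E _ hE] := aut_line s v Gp.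
    exists E => x; rewrite -[x]natr_Zp !GRing.mulr_natl /f.
    by rewrite (aut_column s0 s) // hE /= (aut_column s s0).
  exact: affine_along_gcd.
rewrite (gcd1_connected hn ht con) in aff.
have [a ha] := aff 0%R; exists (f 0%R), a => -[s v] /=.
by rewrite (aut_column s s0) // -/(f v) GRing.mulrC -ha GRing.mulr1 GRing.add0r.
Qed.

(** The slope is invertible since the inverse automorphism is affine as well. *)
Lemma aut_unit p : p \in G ->
  exists c (a : {unit 'Z_n}), forall x, (p x).2 = (c + val a * x.2)%R.
Proof.
move=> Gp; have [c [a h]] := aut_affine Gp.
have [|c' [a' h']] := @aut_affine p^-1; first by rewrite groupV.
have E v : (c' + a' * (c + a * v) = v)%R.
  by have := h' (p (Ordinal ht, v)); rewrite permK h.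
have aa : (a' * a = 1)%R.
  have -> : (a' * a = c' + a' * (c + a * 1) - (c' + a' * (c + a * 0)))%R by ring.
  by rewrite !E GRing.subr0.
have aU : (a \is a GRing.unit)%R.
  by apply/GRing.unitrP; exists a'; rewrite (GRing.mulrC a).
by exists c, (FinRing.unit 'Z_n aU).
Qed.

Lemma aut_unit_jump p c a : p \in G ->
  (forall x, (p x).2 = (c + a * x.2)%R) ->
  forall s v, eq_pm (jump (p (s, v)).1) (a * jump s)%R.
Proof.
move=> Gp h s v; have [E pmE /(_ 1%N)] := aut_line s v Gp.
rewrite !GRing.mulr1n => /(congr1 snd) /=.
by rewrite !h /= GRing.mulrDr GRing.addrA => /GRing.addrI->.
Qed.

End ColumnMap.

(** * The automorphisms given by units *)

Section EqPm.
Variable n : nat.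
Implicit Types x y z : 'Z_n.

Lemma eq_pm_refl x : eq_pm x x.
Proof. by rewrite /eq_pm eqxx. Qed.

Lemma eq_pmP x y : reflect (x = y \/ x = - y)%R (eq_pm x y).
Proof. by apply: (iffP orP) => -[/eqP|/eqP]; by [left|right]. Qed.

Lemma eq_pm_trans y x z : eq_pm x y -> eq_pm y z -> eq_pm x z.
Proof.
move=> /eq_pmP[]-> /eq_pmP[]->; apply/eq_pmP; rewrite ?GRing.opprK; by [left|right].
Qed.

Lemma eq_pmM (a : {unit 'Z_n}) x y :
  eq_pm (val a * x)%R (val a * y)%R = eq_pm x y.
Proof.
by rewrite /eq_pm -GRing.mulrN !(inj_eq (GRing.mulrI (valP a))).
Qed.

End EqPm.

Lemma rearrangement_swap t (be : 'S_t) (s1 s2 : 'I_t) :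
  (s1 < s2)%N -> (be s2 < be s1)%N ->
  (\sum_(s < t) s * be s < \sum_(s < t) s * (tperm s1 s2 * be)%g s)%N.
Proof.
move=> s12 gt; have ne : s2 != s1 by rewrite -val_eqE /= gtn_eqF.
have E (F : 'I_t -> nat) :
    (\sum_s F s = F s1 + F s2 + \sum_(s | (s != s1) && (s != s2)) F s)%N.
  by rewrite (bigD1 s1) // (bigD1 s2) //= addnA.
rewrite !E !permM tpermL tpermR.
rewrite [X in (_ < _ + X)%N](eq_bigr (fun s : 'I_t => s * be s)%N); last first.
  by move=> s /andP[sn1 sn2]; rewrite permM tpermD // eq_sym.
rewrite ltn_add2r; move: gt s12.
by move: (be s1 : nat) (be s2 : nat) (s1 : nat) (s2 : nat) => x y z w; nia.
Qed.

Section Units.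
Variables (n t : nat) (J : t.-tuple nat).
Local Notation jump := (gi_jump n J).
Local Notation G := (gi_aut n J).
Implicit Types (a b : {unit 'Z_n}) (al be : 'S_t).

(** Multiplication by [a] induces [al] on the layers, up to the signs of the
    jumps. *)
Definition scales a al := [forall s, eq_pm (jump (al s)) (val a * jump s)%R].

Lemma scalesP a al :
  reflect (forall s, eq_pm (jump (al s)) (val a * jump s)%R) (scales a al).
Proof. exact: forallP. Qed.

Lemma scales1 : scales 1 1.
Proof. by apply/scalesP=> s; rewrite perm1 GRing.mul1r eq_pm_refl. Qed.

Lemma scalesM a b al be : scales a al -> scales b be -> scales (a * b) (al * be).
Proof.
move=> /scalesP sa /scalesP sb; apply/scalesP=> s; rewrite permM.
apply: eq_pm_trans (sb _) _; rewrite FinRing.val_unitM (GRing.mulrC (val a)).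
by rewrite -GRing.mulrA eq_pmM.
Qed.

Lemma units_msetP a :
  reflect (exists al, scales a al) (a \in gi_units_mset n J).
Proof.
rewrite inE; apply: (iffP existsP) => [[eps]|[al /scalesP sa]].
  pose T := [tuple ((-1) ^+ (eps s) * jump s)%R | s < t].
  case/(@tuple_permP _ _ _ T) => al E; exists al; apply/scalesP=> s.
  have {}E : [tuple (val a * jump r)%R | r < t] = [tuple tnth T (al r) | r < t].
    exact: val_inj.
  have := congr1 (fun u => tnth u s) E; rewrite /= !tnth_mktuple => ->.
  case: (eps _); last by rewrite GRing.mul1r eq_pm_refl.
  by rewrite GRing.mulN1r /eq_pm GRing.opprK eqxx orbT.
exists [ffun r => jump r != (val a * jump (al^-1%g r))%R].
pose T := [tuple ((-1) ^+ ([ffun r => jump r != (val a * jump (al^-1%g r))%R] s)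
   * jump s)%R | s < t].
apply/(@tuple_permP _ _ _ T); exists al; apply: eq_map => s.
rewrite tnth_mktuple ffunE permK; have := sa s; rewrite /eq_pm.
case: eqVneq => [->|_ /= /eqP->]; first by rewrite GRing.mul1r.
by rewrite GRing.mulN1r GRing.opprK.
Qed.

Lemma units_setP a : gi_standard n J -> 2 < n -> uniq J ->
  reflect (exists al, scales a al) (a \in gi_units_set n J).
Proof.
move=> std hn uJ; have pmP x : reflect (exists s, eq_pm (jump s) x) (x \in gi_pm_jumps n J).
  rewrite inE; apply: (iffP orP) => [[]/imsetP[s _ ->]|[s /eq_pmP[]E]].
  - by exists s; apply: eq_pm_refl.
  - by exists s; rewrite /eq_pm GRing.opprK eqxx orbT.
  - by left; apply/imsetP; exists s.
  by right; apply/imsetP; exists s; rewrite // E GRing.opprK.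
rewrite inE; apply: (iffP eqP) => [E|[al /scalesP sa]].
  have ex s : exists r, eq_pm (jump r) (val a * jump s)%R.
    apply/pmP; rewrite -E; apply: imset_f; apply/pmP; exists s; exact: eq_pm_refl.
  have [f hf] := fin_all_exists ex.
  have f_inj : injective f.
    move=> s r fE; have := hf r; rewrite -fE eq_pm_sym => h.
    have := eq_pm_trans h (hf s); rewrite eq_pmM => /(jump_pm_inj hn std).
    by rewrite !(tnth_nth 0) => /eqP; rewrite nth_uniq ?size_tuple // => /eqP/val_inj.
  by exists (perm f_inj); apply/scalesP=> s; rewrite permE.
apply/eqP; rewrite eqEcard card_imset ?leqnn ?andbT; last exact/GRing.mulrI/valP.
apply/subsetP=> _ /imsetP[x /pmP[s sx] ->]; apply/pmP; exists (al s).
by apply: eq_pm_trans (sa s) _; rewrite eq_pmM.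
Qed.

(** By the rearrangement inequality, a scaling permutation which maximizes the
    sum of [s * al s] is increasing on every set of layers whose jumps agree up to
    sign. *)
Lemma layer_perm_spec_exists a al : scales a al ->
  exists be, gi_layer_perm_spec J a be.
Proof.
move=> sa; pose M be := (\sum_(s < t) s * (be s))%N.
case: (@arg_maxnP _ al (scales a) M sa) => be sb maxb; exists be.
rewrite /gi_layer_perm_spec -/(scales a be) sb /=.
apply/forallP=> s1; apply/forallP=> s2; apply/implyP=> /andP[s12 pm12].
rewrite ltnNge; apply/negP => ge.
have ne : s1 != s2 by rewrite -val_eqE /= ltn_eqF.
have gt : (be s2 < be s1)%N.
  by rewrite ltn_neqAle ge andbT val_eqE (inj_eq perm_inj) eq_sym.
have sb' : scales a (tperm s1 s2 * be).
  apply/scalesP=> s; rewrite permM; case: tpermP => [->|->|_ _]; last exact/scalesP.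
    by apply: eq_pm_trans (scalesP _ _ sb _) _; rewrite eq_pmM eq_pm_sym.
  by apply: eq_pm_trans (scalesP _ _ sb _) _; rewrite eq_pmM.
have le : (M (tperm s1 s2 * be)%g <= M be)%N := maxb _ sb'.
suff: (M be < M (tperm s1 s2 * be)%g)%N by rewrite ltnNge le.
exact: rearrangement_swap.
Qed.

Lemma layer_perm_specP a al : reflect
  (scales a al /\ forall s1 s2 : 'I_t, (s1 < s2)%N ->
     eq_pm (jump s1) (jump s2) -> (al s1 < al s2)%N)
  (gi_layer_perm_spec J a al).
Proof.
apply: (iffP andP) => [][sa h]; split=> //.
  move=> s1 s2 s12 pm; move/forallP/(_ s1)/forallP/(_ s2): h.
  by rewrite s12 pm.
apply/forallP=> s1; apply/forallP=> s2; apply/implyP=> /andP[s12 pm].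
exact: h.
Qed.

Lemma layer_perm_spec_uniq a al be :
  gi_layer_perm_spec J a al -> gi_layer_perm_spec J a be -> al = be.
Proof.
(* At the first layer of disagreement the smaller of the two images would have
   to be taken by the other permutation at an earlier layer. *)
have lt (al1 be1 : 'S_t) (s : 'I_t) :
    gi_layer_perm_spec J a al1 -> gi_layer_perm_spec J a be1 ->
    (forall r : 'I_t, (r < s)%N -> al1 r = be1 r) -> ~ (al1 s < be1 s)%N.
  move=> /layer_perm_specP[/scalesP sa _] /layer_perm_specP[/scalesP sb mb] IH.
  set r := be1^-1 (al1 s); have E : be1 r = al1 s by rewrite permKV.
  rewrite -E => ltrs.
  have pm : eq_pm (jump s) (jump r).
    rewrite -(eq_pmM a); apply: eq_pm_trans (sb r).
    by rewrite E eq_pm_sym.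
  case: (ltngtP r s) => [rs|sr|/val_inj rs].
  - move: (IH _ rs); rewrite E => /perm_inj rs'.
    by rewrite rs' ltnn in rs.
  - by have := mb _ _ sr pm; rewrite ltnNge ltnW.
  by rewrite rs ltnn in ltrs.
move=> ha hb; apply/permP=> s.
have [m] := ubnP (s : nat); elim: m s => // m IH s sm.
have IHs (r : 'I_t) : (r < s)%N -> al r = be r.
  by move=> rs; apply: IH; apply: leq_trans rs _.
case: (ltngtP (al s) (be s)) => [h|h|/val_inj//].
  by case: (lt _ _ s ha hb IHs).
by case: (lt _ _ s hb ha _ h) => r /IHs.
Qed.

Lemma layer_permP a : a \in gi_units_mset n J ->
  gi_layer_perm_spec J a (gi_layer_perm J a).
Proof.
case/units_msetP=> al /layer_perm_spec_exists[be hbe].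
by rewrite /gi_layer_perm; case: pickP => //= /(_ be); rewrite hbe.
Qed.

Lemma scales_layer_perm a : a \in gi_units_mset n J -> scales a (gi_layer_perm J a).
Proof. by move/layer_permP/layer_perm_specP=> []. Qed.

Lemma units_mset_group : group_set (gi_units_mset n J).
Proof.
apply/group_setP; split; first by apply/units_msetP; exists 1; exact: scales1.
move=> a b /units_msetP[al sa] /units_msetP[be sb]; apply/units_msetP.
by exists (al * be); apply: scalesM.
Qed.
Canonical units_mset_groupType := Group units_mset_group.

(** The composite satisfies the specification of [a * b], which has only one
    solution. *)
Lemma layer_permM a b : a \in gi_units_mset n J -> b \in gi_units_mset n J ->
  gi_layer_perm J (a * b) = gi_layer_perm J a * gi_layer_perm J b.
Proof.
move=> Ba Bb; apply: (@layer_perm_spec_uniq (a * b)).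
  by apply: layer_permP; apply: groupM.
have /layer_perm_specP[sa ma] := layer_permP Ba.
have /layer_perm_specP[sb mb] := layer_permP Bb.
apply/layer_perm_specP; split; first exact: scalesM.
move=> s1 s2 s12 pm; rewrite !permM; apply: mb; first exact: ma.
apply: eq_pm_trans (scalesP _ _ sa s1) _; rewrite eq_pm_sym.
by apply: eq_pm_trans (scalesP _ _ sa s2) _; rewrite eq_pmM eq_pm_sym.
Qed.

Lemma gi_multE a x : gi_mult J a x = (gi_layer_perm J a x.1, val a * x.2)%R.
Proof. by rewrite permE. Qed.

Lemma mult_morphM : {in gi_units_mset n J &, {morph gi_mult J : a b / a * b}}.
Proof.
move=> a b Ba Bb; apply/permP=> x; rewrite permM !gi_multE /= layer_permM // permM.
by rewrite GRing.mulrA (GRing.mulrC (val b)).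
Qed.
Canonical mult_morphism := Morphism mult_morphM.

Lemma mult_inj : 0 < t -> injective (@gi_mult n t J).
Proof.
move=> t0 a b E; apply: val_inj.
have := congr1 (fun p : {perm gi_vertex n t} => (p (Ordinal t0, 1%R)).2) E.
by rewrite !gi_multE /= !GRing.mulr1.
Qed.

Lemma mult_aut a : a \in gi_units_mset n J -> gi_mult J a \in G.
Proof.
move/scales_layer_perm/scalesP=> sa; apply/graph_autP=> -[s v] [r w].
rewrite !gi_multE /gi_adj /gi_spoke /gi_layer /= (inj_eq perm_inj).
have aI := GRing.mulrI (valP a); rewrite (inj_eq aI).
congr (_ || (_ && _)).
rewrite -(inj_eq aI w (v + _)%R) -(inj_eq aI w (v - _)%R) !GRing.mulrDr GRing.mulrN.
by case/eq_pmP: (sa s) => ->; rewrite // GRing.opprK orbC.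
Qed.

Lemma mult_conj_rot a :
  (gi_mult J a)^-1 * gi_rot n t * gi_mult J a = gi_rot n t ^+ (val a : 'Z_n).
Proof.
apply/permP=> x; rewrite -[x](permKV (gi_mult J a)).
rewrite !permM permK rotXz !gi_multE rotE /=.
by rewrite GRing.mulrDr GRing.mulr1.
Qed.

End Units.

(** * The automorphisms fixing every column *)

Lemma existT_inj (I : eqType) (T_ : I -> eqType) i (x y : T_ i) :
  existT T_ i x = existT T_ i y -> x = y.
Proof. by move/eqP; rewrite -tag_eqE /tag_eq /= eqxx tagged_asE => /eqP. Qed.

Section ColumnKernel.
Variables (n t : nat) (J : t.-tuple nat).
Hypothesis hn : 2 < n.
Hypothesis hJ : forall j, j \in J -> 0 < j < n /\ j.*2 <> n.
Hypothesis std : gi_standard n J.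

Local Notation jump := (gi_jump n J).
Local Notation adj := (gi_adj n J).
Local Notation layer := (@gi_layer n t J).
Local Notation G := (gi_aut n J).
Implicit Types (p : {perm gi_vertex n t}).

Let hn1 : 1 < n. Proof. exact: ltnW. Qed.

Definition column_kernel : {set {perm gi_vertex n t}} :=
  [set p in G | [forall x, (p x).2 == x.2]].

Lemma column_kernelP p :
  reflect (p \in G /\ forall x, (p x).2 = x.2) (p \in column_kernel).
Proof.
have -> : (p \in column_kernel) = (p \in G) && [forall x, (p x).2 == x.2].
  by rewrite [LHS]inE.
apply: (iffP andP) => -[Gp h]; split=> //.
  by move=> x; apply/eqP/(forallP h).
by apply/forallP=> x; rewrite h.
Qed.

Lemma column_kernel_group_set : group_set column_kernel.
Proof.
apply/group_setP; split.
  by apply/column_kernelP; split=> [|x]; rewrite ?group1 ?perm1.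
move=> p q /column_kernelP[Gp hp] /column_kernelP[Gq hq].
by apply/column_kernelP; split=> [|x]; rewrite ?groupM // permM hq hp.
Qed.
Canonical column_kernel_group := Group column_kernel_group_set.

Lemma column_kernelE p s v : p \in column_kernel -> p (s, v) = ((p (s, v)).1, v).
Proof. by case/column_kernelP=> _ h; rewrite [LHS]surjective_pairing h. Qed.

Lemma column_kernel_layer p s v : p \in column_kernel ->
  layer (p (s, v)) (p (s, v + jump s)%R).
Proof.
move=> Kp; have [/gi_autP pA h] := column_kernelP p Kp.
have : adj (p (s, v)) (p (s, v + jump s)%R) by rewrite pA adj_jump.
case/orP=> // /andP[_]; rewrite !h /= -GRing.subr_eq0.
have -> : (v - (v + jump s) = - jump s)%R by ring.
by rewrite GRing.oppr_eq0 (negPf (jump_neq0 hn hJ s)).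
Qed.

Lemma column_kernel_step p s v : p \in column_kernel ->
  (p (s, v + jump s)%R).1 = (p (s, v)).1.
Proof. by move=> Kp; have /andP[/eqP] := column_kernel_layer s v Kp. Qed.

Lemma column_kernel_class p x : p \in column_kernel ->
  tnth J (p x).1 = tnth J x.1.
Proof.
case: x => s v Kp; apply: (jump_pm_inj hn std).
have /andP[_] := column_kernel_layer s v Kp.
have [_ h] := column_kernelP p Kp; rewrite !h /= !(inj_eq (GRing.addrI _)) => pm.
by rewrite eq_pm_sym.
Qed.

Lemma gcd_jump_gt0 j : 0 < gcdn n j.
Proof. by rewrite gcdn_gt0 (ltnW hn1). Qed.

Lemma modZn_add (v w : 'Z_n) g : g %| n -> g %| w -> (v + w)%R = v %[mod g].
Proof.
move=> gn gw; rewrite -[w]natr_Zp Zn_add_natr // val_Zp_nat // modn_dvdm //.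
by rewrite -modnDmr (eqP gw) addn0.
Qed.

Lemma jump_mod (v : 'Z_n) s : (v + jump s)%R = v %[mod gcdn n (tnth J s)].
Proof.
apply: modZn_add; first exact: dvdn_gcdl.
rewrite /gi_jump val_Zp_nat // /dvdn modn_dvdm ?dvdn_gcdl //.
exact: dvdn_gcdr.
Qed.

Lemma jump_reach (v w : 'Z_n) s : v = w %[mod gcdn n (tnth J s)] ->
  exists k, w = (v + jump s *+ k)%R.
Proof.
move=> E; set j := tnth J s in E; have [/andP[j0 _] _] := hJ (mem_tnth s J).
have [k l Ek _] := egcdnP n j0; rewrite gcdnC in Ek; set g := gcdn n j in E Ek.
have gE : (g%:R = k%:R * jump s :> 'Z_n)%R.
  by rewrite -GRing.natrM Ek GRing.natrD GRing.natrM Zn_nat_n // GRing.mulr0 GRing.add0r.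
have modE (u : 'Z_n) : u = ((u %/ g)%:R * g%:R + (u %% g)%:R)%R.
  by rewrite -GRing.natrM -GRing.natrD -divn_eq natr_Zp.
pose x : 'Z_n := (((w %/ g)%:R - (v %/ g)%:R) * k%:R)%R.
have d : (w - v = ((w %/ g)%:R - (v %/ g)%:R) * g%:R)%R.
  by rewrite [X in (X - _)%R]modE [X in (_ - X)%R]modE E; ring.
exists x; rewrite -GRing.mulr_natl natr_Zp /x -GRing.mulrA -gE -d.
by rewrite GRing.addrC GRing.subrK.
Qed.

(** Layers stay put along a line, and a line of jump [j] meets exactly the columns
    of one residue class modulo [gcdn n j]. *)
Lemma column_kernel_mod p s (v w : 'Z_n) : p \in column_kernel ->
  v = w %[mod gcdn n (tnth J s)] -> (p (s, v)).1 = (p (s, w)).1.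
Proof.
move=> Kp /jump_reach[k ->]; elim: k => [|k IH].
  by rewrite GRing.mulr0n GRing.addr0.
by rewrite GRing.mulrSr GRing.addrA column_kernel_step.
Qed.

(** Adjacent columns of a line see the same layer permutation, so two vertices of
    one column share a layer exactly when they are equal, before and after [p]. *)
Lemma column_kernelI p : (forall x, (p x).2 = x.2) ->
  (forall x, tnth J (p x).1 = tnth J x.1) ->
  (forall s v, (p (s, v + jump s)%R).1 = (p (s, v)).1) ->
  p \in column_kernel.
Proof.
move=> p2 pJ pS; apply/column_kernelP; split=> //.
have pE s v : p (s, v) = ((p (s, v)).1, v) by rewrite [LHS]surjective_pairing p2.
have inj1 s r v : ((p (s, v)).1 == (p (r, v)).1) = (s == r).
  apply/eqP/eqP=> [E|->//].
  have : p (s, v) = p (r, v) by rewrite pE E -pE.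
  by move/perm_inj => [].
have jE s v : jump (p (s, v)).1 = jump s by rewrite /gi_jump pJ.
apply/gi_autP=> -[s v] [r y]; rewrite pE [p (r, y)]pE /gi_adj /gi_spoke /gi_layer /=.
rewrite jE; congr orb.
  by case: (eqVneq v y) => [->|]; rewrite ?andbF // inj1.
have [/orP yv|] := boolP ((y == _) || _); last by rewrite !andbF.
suff -> : (p (s, v)).1 = (p (s, y)).1 by rewrite inj1.
case: yv => /eqP->; first by rewrite pS.
by rewrite -[in LHS](GRing.subrK (jump s) v) pS.
Qed.

Lemma swapE i s1 s2 x : gi_swap n J i s1 s2 x = gi_swap_fun J i s1 s2 x.
Proof. by rewrite permE. Qed.

Lemma swap_column_kernel i s1 s2 : tnth J s1 = tnth J s2 ->
  gi_swap n J i s1 s2 \in column_kernel.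
Proof.
move=> E; apply: column_kernelI => [x|x|s v]; rewrite !swapE /gi_swap_fun.
- by case: ifP.
- by case: ifP => //= _; case: tpermP => // ->.
case: (boolP (tnth J s == tnth J s1)) => [/eqP Es|ns] /=.
  by rewrite -Es jump_mod; case: ifP.
have s1s : s1 != s by apply: contraNneq ns => ->.
have s2s : s2 != s by apply: contraNneq ns => <-; rewrite E.
by rewrite tpermD //; case: ifP; case: ifP.
Qed.

Lemma swaps_sub_column_kernel : <<gi_swaps n J>> \subset column_kernel.
Proof.
rewrite gen_subG; apply/subsetP=> p; rewrite inE.
case/existsP=> s1 /existsP[s2 /existsP[i /and3P[_ /eqP E /eqP->]]].
exact: swap_column_kernel.
Qed.

(** If [p] moves [(s1, v)] to [(s2, v)], following [p] by the swap of these two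
    layers on the residue class of [v] fixes [(s1, v)] and every vertex that was
    already fixed. *)
Lemma column_kernel_sub_swaps : column_kernel \subset <<gi_swaps n J>>.
Proof.
apply/subsetP=> p; have [m] := ubnP #|[set x | p x != x]|.
elim: m p => // m IH p pm Kp.
case: (pickP (fun x => p x != x)) => [[s1 v] pv|p1]; last first.
  by have -> : p = 1 by apply/permP=> x; rewrite perm1; apply/eqP/negbFE/p1.
set s2 := (p (s1, v)).1; have pE : p (s1, v) = (s2, v) by exact: column_kernelE.
have s12 : s1 != s2 by apply: contraNneq pv => e; rewrite pE -e.
have E : tnth J s1 = tnth J s2 by rewrite /s2 (column_kernel_class _ Kp).
pose q := gi_swap n J (v %% gcdn n (tnth J s1)) s1 s2.
have Sq : q \in <<gi_swaps n J>>.
  apply: mem_gen; rewrite inE; apply/existsP; exists s1; apply/existsP; exists s2.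
  apply/existsP; exists (Ordinal (ltn_pmod v (gcd_jump_gt0 (tnth J s1)))).
  by apply/and3P; split=> //; apply/eqP.
rewrite -(groupMr _ Sq); apply: IH; last first.
  by rewrite groupM // swap_column_kernel.
rewrite ltnS in pm; apply: leq_trans pm; apply: proper_card; apply/properP; split.
  apply/subsetP=> -[s w]; rewrite !inE; apply: contra => /eqP pw.
  rewrite permM pw swapE /gi_swap_fun /= modn_mod.
  have [wv|//] := eqVneq (w %% gcdn n (tnth J s1))%N (v %% gcdn n (tnth J s1))%N.
  have pw1 : p (s1, w) = (s2, w).
    by rewrite column_kernelE // (column_kernel_mod Kp wv) pE.
  rewrite tpermD //; apply/eqP=> es.
    by move: (congr1 fst pw); rewrite -es pw1 /= => e; rewrite e eqxx in s12.
  move: pw; rewrite -es -pw1 => /perm_inj; rewrite pw1 => /(congr1 fst)/= e.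
  by rewrite e eqxx in s12.
exists (s1, v); rewrite !inE // permM pE swapE /gi_swap_fun /= modn_mod eqxx.
by rewrite tpermR eqxx.
Qed.

Lemma swaps_genE : <<gi_swaps n J>> = column_kernel.
Proof.
by apply/eqP; rewrite eqEsubset swaps_sub_column_kernel column_kernel_sub_swaps.
Qed.

(* A layer is encoded by its entry [j] and its position among the layers with that
   entry. *)
Local Notation slot := {j : seq_sub J & 'I_(count_mem (val j) J)}.

Lemma card_class j : #|[set s | tnth J s == j]| = count_mem j J.
Proof.
rewrite cardsE cardE /enum_mem size_filter -[in RHS](map_tnth_enum J) count_map.
by rewrite enumT; apply: eq_count => s.
Qed.

Definition slot_layer (u : slot) : 'I_t :=
  enum_val (cast_ord (esym (card_class (val (tag u)))) (tagged u)).

Lemma slot_layer_class u : tnth J (slot_layer u) = val (tag u).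
Proof.
have := enum_valP (cast_ord (esym (card_class (val (tag u)))) (tagged u)).
by rewrite inE => /eqP.
Qed.

Lemma slot_layer_inj : injective slot_layer.
Proof.
move=> u w E; have e : tag u = tag w.
  by apply: val_inj; rewrite -!slot_layer_class E.
case: u w e E => j k [j' k'] /= e; subst j' => /enum_val_inj/cast_ord_inj/= ->.
by [].
Qed.

Lemma mem_class s : s \in [set r | tnth J r == tnth J s].
Proof. by rewrite inE. Qed.

Definition layer_slot s : slot :=
  existT _ (SeqSub (mem_tnth s J))
    (cast_ord (card_class _) (enum_rank_in (mem_class s) s)).

Lemma layer_slotK : cancel layer_slot slot_layer.
Proof. by move=> s; rewrite /slot_layer /= cast_ordK enum_rankK_in ?mem_class. Qed.

Lemma slot_layerK : cancel slot_layer layer_slot.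
Proof. by move=> u; apply: slot_layer_inj; rewrite layer_slotK. Qed.

Local Notation P := (gi_sym_prod n J).
Implicit Types f g : P.

Definition residue j (v : 'Z_n) : 'I_(gcdn n j) :=
  Ordinal (ltn_pmod v (gcd_jump_gt0 j)).

Lemma residue_jump s v : residue (tnth J s) (v + jump s)%R = residue (tnth J s) v.
Proof. by apply: val_inj; rewrite /= jump_mod. Qed.

Lemma residue_surj j (i : 'I_(gcdn n j)) : residue j (i%:R)%R = i.
Proof.
apply: val_inj; rewrite /= val_Zp_nat // modn_dvdm ?dvdn_gcdl //.
exact: modn_small.
Qed.

(** The layer of column [v] at position [k] of the class [j] moves to the position
    prescribed by the component of [f] at [j] and the residue of [v]. *)
Definition permute_slot f (v : 'Z_n) (u : slot) : slot :=
  existT _ (tag u) (f (tag u) (residue (val (tag u)) v) (tagged u)).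

Definition permute_fun f (x : gi_vertex n t) : gi_vertex n t :=
  (slot_layer (permute_slot f x.2 (layer_slot x.1)), x.2).

Lemma permute_funE f u v :
  permute_fun f (slot_layer u, v) = (slot_layer (permute_slot f v u), v).
Proof. by rewrite /permute_fun slot_layerK. Qed.

Lemma permute_inj f : injective (permute_fun f).
Proof.
move=> [s v] [r w]; rewrite -(layer_slotK s) -(layer_slotK r) !permute_funE.
case=> + vw; subst w; move/slot_layer_inj; move: (layer_slot s) (layer_slot r).
move=> [j k] [j' k'] E.
have e : j = j' := congr1 tag E.
subst j'; have Ek : f j (residue (val j) v) k = f j (residue (val j) v) k'.
  exact: (@existT_inj _ (fun j : seq_sub J => 'I_(count_mem (val j) J)) _ _ _ E).
by rewrite (perm_inj Ek).
Qed.

Definition permute f : {perm gi_vertex n t} := perm (@permute_inj f).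

Lemma permuteE f u v : permute f (slot_layer u, v) = (slot_layer (permute_slot f v u), v).
Proof. by rewrite permE permute_funE. Qed.

Lemma permute_morphM : {in [set: P] &, {morph permute : f g / f * g}}.
Proof.
move=> f g _ _; apply/permP=> -[s v]; rewrite -(layer_slotK s) permM !permuteE.
by rewrite /permute_slot /= !mulg_ffun permM.
Qed.
Canonical permute_morphism := Morphism permute_morphM.

Lemma injm_permute : 'injm permute.
Proof.
apply/injmP=> f g _ _ E; apply/ffunP=> j; apply/ffunP=> i; apply/permP=> k.
have := congr1 (fun p : {perm gi_vertex n t} =>
  (p (slot_layer (existT _ j k), i%:R)%R).1) E.
rewrite !permuteE /= => /slot_layer_inj; rewrite /permute_slot /= residue_surj.
exact: existT_inj.
Qed.

Lemma permute_column_kernel f : permute f \in column_kernel.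
Proof.
apply: column_kernelI => [[s v]|[s v]|s v]; rewrite -(layer_slotK s);
  move: (layer_slot s) => u; rewrite !permuteE //=.
  by rewrite !slot_layer_class.
have E : residue (val (tag u)) (v + jump (slot_layer u))%R = residue (val (tag u)) v.
  by rewrite -slot_layer_class residue_jump.
by rewrite /permute_slot E.
Qed.

(** An element of the kernel is recovered from its action on the columns [i] with
    [i < gcdn n j], one for each residue class. *)
Lemma im_permute : permute @* setT = column_kernel.
Proof.
apply/eqP; rewrite eqEsubset; apply/andP; split.
  by apply/subsetP=> _ /morphimP[f _ _ ->]; apply: permute_column_kernel.
apply/subsetP=> p Kp.
have ex (j : seq_sub J) (i : 'I_(gcdn n (val j))) :
    exists sg : 'S_(count_mem (val j) J), forall k,
    p (slot_layer (existT _ j k), i%:R)%R = (slot_layer (existT _ j (sg k)), i%:R)%R.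
  have exk (k : 'I_(count_mem (val j) J)) : exists k' : 'I_(count_mem (val j) J),
      p (slot_layer (existT _ j k), i%:R)%R = (slot_layer (existT _ j k'), i%:R)%R.
    rewrite column_kernelE //; set s := (p _).1.
    have /= := column_kernel_class (slot_layer (existT _ j k), i%:R)%R Kp.
    rewrite -/s slot_layer_class /= -(layer_slotK s); case: (layer_slot s) => j' k'.
    rewrite slot_layer_class /= => /val_inj e; subst j'.
    by exists k'.
  have [f hf] := fin_all_exists exk.
  have f_inj : injective f.
    move=> k k' e; have : p (slot_layer (existT _ j k), i%:R)%R =
      p (slot_layer (existT _ j k'), i%:R)%R by rewrite !hf e.
    move/perm_inj/(congr1 fst) => /= /slot_layer_inj.
    exact: existT_inj.
  by exists (perm f_inj) => k; rewrite permE.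
have ex2 (j : seq_sub J) : exists F : {dffun forall _ : 'I_(gcdn n (val j)), 'S_(count_mem (val j) J)},
    forall (i : 'I_(gcdn n (val j))) k, p (slot_layer (existT _ j k), i%:R)%R =
      (slot_layer (existT _ j (F i k)), i%:R)%R.
  have [F hF] := fin_all_exists (ex j).
  by exists [ffun i => F i] => i k; rewrite ffunE.
have [F hF] := fin_all_exists ex2.
apply/morphimP; exists (finfun F : P); rewrite ?inE //; apply/permP=> -[s v].
rewrite -(layer_slotK s); case: (layer_slot s) => j k.
rewrite permuteE column_kernelE //; congr (_, _); rewrite /permute_slot /= ffunE.
rewrite (@column_kernel_mod p _ v ((residue (val j) v)%:R)%R) //.
  by rewrite hF.
rewrite slot_layer_class /= val_Zp_nat // modn_dvdm ?dvdn_gcdl //=.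
by rewrite modn_mod.
Qed.

Lemma swaps_isog : <<gi_swaps n J>> \isog [set: P].
Proof.
rewrite swaps_genE isog_sym; apply/isogP; exists permute_morphism.
  exact: injm_permute.
exact: im_permute.
Qed.

Lemma card_sym_prod :
  #|[set: P]| = (\prod_(j <- undup J) (count_mem j J)`! ^ gcdn n j)%N.
Proof.
rewrite cardsT card_dep_ffun foldrE big_map enumT.
transitivity (\prod_(j : seq_sub J) (count_mem (val j) J)`! ^ gcdn n (val j))%N.
  by apply: eq_bigr => j _; rewrite card_ffun card_ord card_Sn.
rewrite -(big_map val predT (fun j => (count_mem j J)`! ^ gcdn n j)%N).
apply: perm_big; apply: uniq_perm.
- by rewrite map_inj_uniq ?index_enum_uniq //; apply: val_inj.
- exact: undup_uniq.
move=> j; rewrite mem_undup; apply/mapP/idP => [[u _ ->]|Jj]; first exact: valP.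
by exists (SeqSub Jj); rewrite ?mem_index_enum.
Qed.

End ColumnKernel.

(** * The structure of the automorphism group *)

Section RotationGroup.
Variables (n t : nat).
Hypothesis hn : 2 < n.
Hypothesis ht : 0 < t.
Local Notation rho := (gi_rot n t).

Definition rot_power (x : 'Z_n) : {perm gi_vertex n t} := rho ^+ x.

Lemma rot_powerE c x : rot_power c x = (x.1, x.2 + c)%R.
Proof. exact: rotXz. Qed.

Lemma rot_powerM : {in [set: 'Z_n] &, {morph rot_power : x y / (x + y)%R >-> x * y}}.
Proof.
move=> x y _ _; apply/permP=> u.
by rewrite permM !rot_powerE /= GRing.addrA.
Qed.
Canonical rot_power_morphism :=
  @Morphism _ _ [set: 'Z_n] rot_power rot_powerM.

Lemma injm_rot_power : 'injm rot_power.
Proof.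
apply/injmP=> x y _ _ E.
have := congr1 (fun p : {perm gi_vertex n t} => (p (Ordinal ht, 0%R)).2) E.
by rewrite !rot_powerE /= !GRing.add0r.
Qed.

Lemma rot_power_nat k : rho ^+ k = rot_power (k%:R)%R.
Proof. by apply/permP=> x; rewrite rot_powerE rotX. Qed.

Lemma im_rot_power : rot_power @* [set: 'Z_n] = <[rho]>.
Proof.
apply/eqP; rewrite eqEsubset; apply/andP; split; apply/subsetP=> p.
  by case/morphimP=> x _ _ ->; apply: mem_cycle.
case/cycleP=> k ->; rewrite rot_power_nat.
exact: (mem_morphim rot_power_morphism (in_setT _) (in_setT _)).
Qed.

Lemma card_rot : #|<[rho]>| = n.
Proof.
rewrite -im_rot_power card_injm ?injm_rot_power // cardsT card_ord.
by rewrite Zp_cast // ltnW.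
Qed.

End RotationGroup.

Section Structure.
Variables (n t : nat) (J : t.-tuple nat).
Hypothesis hn : 2 < n.
Hypothesis ht : 0 < t.
Hypothesis hJ : forall j, j \in J -> 0 < j < n /\ j.*2 <> n.
Hypothesis std : gi_standard n J.
Hypothesis con : graph_connected (gi_adj n J).
Hypothesis nET : ~ edge_transitive (gi_adj n J).

Local Notation jump := (gi_jump n J).
Local Notation G := (gi_aut n J).
Local Notation rho := (gi_rot n t).
Local Notation B := (gi_units_mset n J).
Local Notation N := (column_kernel n J).
Local Notation S := (gi_mult J @: B).

Lemma im_mult : mult_morphism n J @* B = S.
Proof. by rewrite morphimEdom. Qed.

Lemma mults_group_set : group_set S.
Proof. by rewrite -im_mult; apply: groupP. Qed.
Canonical mults_group := Group mults_group_set.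

Lemma injm_mult : 'injm (mult_morphism n J).
Proof. by apply/injmP=> a b _ _; apply: mult_inj. Qed.

Lemma mults_isog : S \isog B.
Proof.
rewrite isog_sym; apply/isogP; exists (mult_morphism n J); first exact: injm_mult.
exact: im_mult.
Qed.

Lemma mults_sub : S \subset G.
Proof. by apply/subsetP=> _ /imsetP[a Ba ->]; apply: mult_aut. Qed.

(** If [p] acts on columns as [v] to [c + a v], its layer permutation in column 0
    shows that [a] scales the jumps; composing with the inverse of [sigma_a] leaves
    the translation by [a^-1 c], which the rotation undoes. *)
Lemma aut_decomposition p : p \in G ->
  exists q k a, [/\ q \in N, a \in B & p = q * rho ^+ k * gi_mult J a].
Proof.
move=> Gp; have [c [a pE]] := aut_unit hn ht hJ std con nET Gp.
have Ba : a \in B.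
  have inj0 : injective (fun s => (p (s, 0%R)).1).
    move=> s r E; have : p (s, 0%R) = p (r, 0%R).
      by rewrite [LHS]surjective_pairing [RHS]surjective_pairing E !pE.
    by move/perm_inj/(congr1 fst).
  apply/units_msetP; exists (perm inj0); apply/scalesP=> s; rewrite permE.
  exact: (aut_unit_jump hn hJ std nET Gp pE).
pose d : 'Z_n := ((val a)^-1 * c)%R.
exists (p * (gi_mult J a)^-1 * (rho ^+ d)^-1), d, a; split=> //; last first.
  by rewrite !mulgKV.
apply/column_kernelP; split=> [|x].
  by rewrite !groupM ?groupV ?groupX ?rot_aut ?mult_aut.
rewrite !permM; set y := (gi_mult J a)^-1 (p x).
have y2 : y.2 = (x.2 + d)%R.
  apply: (GRing.mulrI (valP a)); rewrite GRing.mulrDr /d GRing.mulrA.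
  rewrite GRing.divrr ?(valP a) // GRing.mul1r GRing.addrC -pE.
  by rewrite -[p x](permKV (gi_mult J a)) gi_multE.
set z := (rho ^+ d)^-1 y; have zE : (rho ^+ d) z = y by rewrite permKV.
by move: y2; rewrite -zE rotXz /= => /GRing.addIr.
Qed.

(** It is the kernel of the action on columns. *)
Lemma column_kernel_normal : N <| G.
Proof.
apply/andP; split.
  by apply/subsetP=> p /column_kernelP[].
apply/subsetP=> g Gg; rewrite inE; apply/subsetP=> _ /imsetP[q Nq ->].
have /column_kernelP[Gq q2] := Nq.
apply/column_kernelP; split=> [|x]; first by rewrite groupJ.
have [c [a gE]] := aut_unit hn ht hJ std con nET Gg.
rewrite -[x](permKV g) /conjg !permM permK.
by rewrite !gE q2.
Qed.

Lemma column_kernel_rot : N :&: <[rho]> = 1.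
Proof.
apply/trivgP/subsetP=> p /setIP[/column_kernelP[_ p2] /cycleP[k E]].
apply/set1P/permP=> x; have := p2 x; rewrite perm1 E rotX /=.
by rewrite -[X in _ = X]GRing.addr0 => /GRing.addrI->; rewrite GRing.addr0 -surjective_pairing.
Qed.

Lemma rot_norm_column_kernel : <[rho]> \subset 'N(N).
Proof.
have /andP[_ nNG] := column_kernel_normal; apply: subset_trans nNG.
by rewrite cycle_subG rot_aut.
Qed.

Lemma column_kernel_rot_sdprod : N ><| <[rho]> = N <*> <[rho]>.
Proof.
apply: sdprodEY; [exact: rot_norm_column_kernel | exact: column_kernel_rot].
Qed.

(** On columns these elements act by translations; multiplication by a unit is a
    translation only when the unit is 1. *)
Lemma mem_joinP p : p \in N <*> <[rho]> ->
  exists c, forall x, (p x).2 = (x.2 + c)%R.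
Proof.
rewrite norm_joinEr ?rot_norm_column_kernel //.
case/mulsgP=> q _ /column_kernelP[_ q2] /cycleP[k ->] ->.
by exists (k%:R)%R => x; rewrite permM rotX q2.
Qed.

Lemma mults_norm_rot : S \subset 'N(<[rho]>).
Proof.
apply/subsetP=> _ /imsetP[a Ba ->]; rewrite inE -cycleJ cycle_subG.
by rewrite /conjg mulgA mult_conj_rot mem_cycle.
Qed.

Lemma aut_sdprod : N <*> <[rho]> ><| S = G.
Proof.
rewrite sdprodE.
- apply/eqP; rewrite eqEsubset; apply/andP; split.
    rewrite mul_subG ?mults_sub // join_subG normal_sub ?column_kernel_normal //=.
    by rewrite cycle_subG rot_aut.
  apply/subsetP=> p /aut_decomposition[q [k [a [Nq Ba ->]]]].
  rewrite mem_mulg ?imset_f // groupM //.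
    by rewrite (subsetP (joing_subl _ _)).
  by rewrite (subsetP (joing_subr _ _)) // mem_cycle.
- rewrite normsY ?mults_norm_rot //.
  by have /andP[_ nNG] := column_kernel_normal; apply: subset_trans nNG; apply: mults_sub.
apply/trivgP/subsetP=> p /setIP[/mem_joinP[c pc] /imsetP[a Ba E]].
have c0 : c = 0%R.
  by have := pc (Ordinal ht, 0%R); rewrite E gi_multE /= GRing.mulr0 GRing.add0r.
have -> : p = gi_mult J 1.
  rewrite E; congr gi_mult; apply: val_inj; have := pc (Ordinal ht, 1%R).
  by rewrite E gi_multE c0 /= GRing.mulr1 GRing.addr0.
by rewrite (morph1 (mult_morphism n J)) inE.
Qed.

Lemma aut_sdprod3 : N ><| <[rho]> ><| S = G.
Proof. by rewrite column_kernel_rot_sdprod aut_sdprod. Qed.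

Lemma aut_gen : G = <<N :|: [set rho] :|: S>>.
Proof.
apply/eqP; rewrite eqEsubset gen_subG !subUset sub1set rot_aut mults_sub.
rewrite normal_sub ?column_kernel_normal // !andbT.
apply/subsetP=> p /aut_decomposition[q [k [a [Nq Ba ->]]]].
have Sa : gi_mult J a \in S by apply: imset_f.
by rewrite !groupM ?groupX // mem_gen // !in_setU ?Nq ?Sa ?set11 ?orbT.
Qed.

Lemma card_aut :
  #|G| = (n * #|B| * \prod_(j <- undup J) (count_mem j J)`! ^ gcdn n j)%N.
Proof.
rewrite -(sdprod_card aut_sdprod) -(sdprod_card column_kernel_rot_sdprod).
rewrite card_rot // -(card_isog mults_isog) -(swaps_genE hn hJ std).
rewrite (card_isog (swaps_isog hn hJ std)) card_sym_prod //=.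
by rewrite -mulnA mulnC.
Qed.

Lemma aut_sdprod_by : exists (gB : group_set B)
    (to1 : groupAction [set: 'Z_n] [set: gi_sym_prod n J])
    (to2 : groupAction (Group gB) [set: sdprod_by to1]),
  G \isog [set: sdprod_by to2].
Proof.
have Nisog : N \isog [set: gi_sym_prod n J].
  by rewrite -(swaps_genE hn hJ std); apply: swaps_isog.
have Risog : <[rho]> \isog [set: 'Z_n].
  rewrite isog_sym; apply/isogP; exists (rot_power_morphism n t).
    exact: injm_rot_power.
  exact: im_rot_power.
have [to1 iso1] := sdprod_by_exists column_kernel_rot_sdprod Nisog Risog.
have [to2 iso2] := sdprod_by_exists aut_sdprod iso1 mults_isog.
by exists (units_mset_group n J), to1, to2.
Qed.

Section Distinct.
Hypothesis uJ : uniq J.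

Lemma units_set_mset : gi_units_set n J = B.
Proof.
by apply/setP=> a; apply/(@units_setP n t J a std hn uJ)/(@units_msetP n t J a).
Qed.

Lemma column_kernel1 : N = 1.
Proof.
rewrite -(swaps_genE hn hJ std); apply/trivgP; rewrite gen_subG.
apply/subsetP=> p; rewrite inE.
case/existsP=> s1 /existsP[s2 /existsP[i /and3P[ne /eqP E _]]].
by rewrite (tuple_uniqP _ uJ _ _ E) eqxx in ne.
Qed.

Lemma rot_sdprod : <[rho]> ><| S = G.
Proof. by rewrite -aut_sdprod3 column_kernel1 sdprod1g. Qed.

Lemma rot_gen : G = <<rho |: S>>.
Proof. by rewrite -(sdprodWY rot_sdprod) joing_idl. Qed.

Lemma rot_sdprod_by (gB : group_set B) :
  G \isog [set: sdprod_by ('U \ subsetT (Group gB))%gact].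
Proof.
pose h := @Morphism _ _ (Group gB) (gi_mult J) (@mult_morphM n t J).
apply: (@sdprod_by_isog _ _ _ <[rho]>%G mults_group (gi_aut_group n J)
  (Group gB) [set: 'Z_n]%G ('U \ subsetT (Group gB))%gact
  (rot_power_morphism n t) h).
- exact: injm_rot_power.
- by apply/injmP=> a b _ _; apply: mult_inj.
- exact: im_rot_power.
- exact: im_mult.
- move=> x a _ _.
  suff E : rot_power t (x * val a)%R = rot_power t x ^ gi_mult J a by exact: E.
  rewrite /rot_power conjXg /conjg mulgA mult_conj_rot.
  apply/permP=> u; rewrite -expgM !rotX GRing.natrM !natr_Zp.
  by rewrite (GRing.mulrC (val a)).
exact: rot_sdprod.
Qed.

End Distinct.
End Structure.

Theorem mainTheorem3 (n t : nat) (J : t.-tuple nat)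
    (hn : 3 <= n) (ht : 1 <= t)
    (hJ : forall j, j \in J -> 0 < j < n /\ j.*2 <> n) :
  (let d := gi_gcd n J in
   let A' := gi_aut (n %/ d) (gi_quo n J) in
     gi_aut n J \isog [set: wreath [subg A']%type d] /\
     #|gi_aut n J| = (d`! * #|A'| ^ d)%N)
  /\
  (gi_standard n J -> uniq J -> graph_connected (gi_adj n J) ->
   ~ edge_transitive (gi_adj n J) ->
   let G := gi_aut n J in
   let rho := gi_rot n t in
   let A := gi_units_set n J in
   let S := [set gi_mult J a | a in A] in
   [/\ group_set A,
       group_set S /\ S \subset G,
       S \isog A &
   [/\ G = <<rho |: S>>,
       <[rho]> ><| S = G,
       exists gA : group_set A,
         G \isog [set: sdprod_by ('U \ subsetT (Group gA))%gact],
       forall a : {unit 'Z_n}, a \in A ->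
         (gi_mult J a)^-1 * rho * gi_mult J a = rho ^+ (val a : 'Z_n) &
       #|G| = (n * #|A|)%N]])
  /\
  (gi_standard n J -> ~~ uniq J -> graph_connected (gi_adj n J) ->
   ~ edge_transitive (gi_adj n J) ->
   let G := gi_aut n J in
   let rho := gi_rot n t in
   let B := gi_units_mset n J in
   let S := [set gi_mult J a | a in B] in
   let N := <<gi_swaps n J>> in
   [/\ group_set B,
       group_set S /\ S \subset G,
       S \isog B,
       N <| G &
   [/\ N \isog [set: gi_sym_prod n J],
       G = <<N :|: [set rho] :|: S>>,
       N ><| <[rho]> ><| S = G,
       exists (gB : group_set B)
           (to1 : groupAction [set: 'Z_n] [set: gi_sym_prod n J])
           (to2 : groupAction (Group gB) [set: sdprod_by to1]),
         G \isog [set: sdprod_by to2] &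
       #|G| = (n * #|B| * \prod_(j <- undup J) (count_mem j J)`! ^ gcdn n j)%N]]).
Proof.
split; first exact: gi_aut_wreath.
split=> [std uJ con nET|std _ con nET]; move=> G rho.
  rewrite /= (units_set_mset hn std uJ).
  have defG := rot_sdprod hn ht hJ std con nET uJ.
  split; [exact: units_mset_group | split | exact: mults_isog |].
  - exact: mults_group_set.
  - exact: mults_sub.
  split.
  - exact: rot_gen.
  - exact: defG.
  - exists (units_mset_group n J); exact: rot_sdprod_by.
  - by move=> a _; apply: mult_conj_rot.
  rewrite -(sdprod_card defG) card_rot //.
  by rewrite (card_isog (@mults_isog n t J ht)).
have defN := swaps_genE hn hJ std.
split; [exact: units_mset_group | split | exact: mults_isog | |].
- exact: mults_group_set.
- exact: mults_sub.
- by rewrite defN; apply: column_kernel_normal.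
split.
- exact: swaps_isog.
- by rewrite defN; apply: aut_gen.
- by rewrite defN; apply: aut_sdprod3.
- exact: aut_sdprod_by.
exact: card_aut.
Qed.
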